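(* Let $h$ be a fixed positive integer and let $$S(x;h):=\sum_{1\le n\le x,\ n\neq h} d(n)\,d(n-h)\,d(n+h).$$ Then, as $x\to\infty$, $S(x;h)\ll_h x(\log x)^3$, i.e. there is a constant $C_h>0$ depending only on $h$ such that $S(x;h)\le C_h\,x(\log x)^3$ for all sufficiently large $x$.
   Context: For a nonzero integer $m$, $d(m)$ denotes the number of positive divisors of $m$ (so $d(m)=d(|m|)$). *)

(* Defs.v *)
From Stdlib Require Import Reals Lra Lia ZArith Arith List.
Open Scope R_scope.

(* d(m): number of positive divisors of m (for m : nat; d 0 = 0 unused). *)
Definition ndiv (m : nat) : nat :=
  length (filter (fun k => Nat.eqb (m mod k) 0) (List.seq 1 m)).

(* |n - h| for naturals: d(n-h) = d(|n-h|). *)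
Definition natdist (n h : nat) : nat := if Nat.leb h n then n - h else h - n.

Definition Sterm (h n : nat) : R :=
  if Nat.eqb n h then 0
  else INR (ndiv n * ndiv (natdist n h) * ndiv (n + h)).

Definition S (x : R) (h : nat) : R :=
  fold_right Rplus 0
    (map (Sterm h) (List.seq 1 (Z.to_nat (Int_part x)))).

(* Main.v *)
(* Only divisors up to x^(1/3) of each factor can be used: if abc <= x then the
   number of n <= x with a | n, b | n - h, c | n + h is O_h(x / abc), because
   such n differ by multiples of a number at least abc / (2h^3). So it suffices
   to majorise d(n), for n <= 2x, by a sum of weights w(m) over divisors
   m <= x^(1/3) of n, with sum_m w(m) / m = O(log x).

   Let z ~ x^(1/6), write n = a b where a <= z is the longest product of the
   smallest prime factors of n, and let q be the least prime factor of b. If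
   q > sqrt z then d(b) = O(1) and d(n) << #{v | n : v <= z}. Otherwise a is
   q-smooth and a >= sqrt z, while d(b) << b^eps with eps = min(1/32, 1/log q);
   hence d(n) << z^(-eps) d(a) a^(16 eps). Expanding a^(16 eps) = sum_(u | a) g(u)
   gives the weight z^(-eps) g(u) on the divisor lcm(u, v) q of n. The g(u)
   contribute O(1), since sum_(p <= q) log p / p << log q, the v contribute
   O(log z), and sum_q z^(-eps) / q = O(1) by the same estimate over primes. *)

Require Import Defs.
From Stdlib Require Import Reals Lra Lia ZArith Arith List Sorted.
Open Scope R_scope.

(** * Finite sums *)

Definition sumR {A : Type} (f : A -> R) (l : list A) : R :=
  fold_right Rplus 0 (map f l).

Lemma sumR_cons {A} (f : A -> R) x l : sumR f (x :: l) = f x + sumR f l.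
Proof. reflexivity. Qed.

Lemma sumR_nil {A} (f : A -> R) : sumR f nil = 0.
Proof. reflexivity. Qed.

Lemma sumR_app {A} (f : A -> R) l l' : sumR f (l ++ l') = sumR f l + sumR f l'.
Proof. induction l as [|x l IH]; simpl; rewrite ?sumR_cons, ?IH; [unfold sumR; simpl|]; lra. Qed.

Lemma sumR_map {A B} (g : A -> B) (f : B -> R) l :
  sumR f (map g l) = sumR (fun x => f (g x)) l.
Proof. unfold sumR; now rewrite map_map. Qed.

Lemma sumR_flat_map {A B} (g : A -> list B) (f : B -> R) l :
  sumR f (flat_map g l) = sumR (fun x => sumR f (g x)) l.
Proof. induction l as [|x l IH]; simpl; [reflexivity|]. now rewrite sumR_app, sumR_cons, IH. Qed.

Lemma sumR_le {A} (f g : A -> R) l :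
  (forall x, In x l -> f x <= g x) -> sumR f l <= sumR g l.
Proof.
  induction l as [|x l IH]; intros H; [unfold sumR; simpl; lra|].
  rewrite !sumR_cons. apply Rplus_le_compat; [apply H; now left|].
  apply IH; intros y Hy; apply H; now right.
Qed.

Lemma sumR_ext {A} (f g : A -> R) l :
  (forall x, In x l -> f x = g x) -> sumR f l = sumR g l.
Proof. intros H; apply Rle_antisym; apply sumR_le; intros x Hx; rewrite (H x Hx); lra. Qed.

Lemma sumR_0 {A} (l : list A) : sumR (fun _ => 0) l = 0.
Proof. induction l as [|x l IH]; [reflexivity|]. rewrite sumR_cons, IH; lra. Qed.

Lemma sumR_nonneg {A} (f : A -> R) l : (forall x, In x l -> 0 <= f x) -> 0 <= sumR f l.
Proof. intros H. rewrite <- (sumR_0 l). now apply sumR_le. Qed.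

Lemma sumR_scal {A} c (f : A -> R) l : sumR (fun x => c * f x) l = c * sumR f l.
Proof. induction l as [|x l IH]; [unfold sumR; simpl; lra|]. rewrite !sumR_cons, IH; lra. Qed.

Lemma sumR_plus {A} (f g : A -> R) l :
  sumR (fun x => f x + g x) l = sumR f l + sumR g l.
Proof. induction l as [|x l IH]; [unfold sumR; simpl; lra|]. rewrite !sumR_cons, IH; lra. Qed.

Lemma sumR_swap {A B} (f : A -> B -> R) l l' :
  sumR (fun x => sumR (f x) l') l = sumR (fun y => sumR (fun x => f x y) l) l'.
Proof.
  induction l as [|x l IH].
  - symmetry; apply sumR_0.
  - rewrite sumR_cons, IH, <- sumR_plus. now apply sumR_ext.
Qed.

Lemma sumR_filter {A} (b : A -> bool) (f : A -> R) l :
  sumR f (filter b l) = sumR (fun x => if b x then f x else 0) l.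
Proof.
  induction l as [|x l IH]; [reflexivity|].
  simpl; rewrite sumR_cons; destruct (b x); rewrite ?sumR_cons, IH; lra.
Qed.

Lemma sumR_const {A} c (l : list A) : sumR (fun _ => c) l = c * INR (length l).
Proof.
  induction l as [|x l IH]; [unfold sumR; simpl; lra|].
  rewrite sumR_cons, IH; simpl length; rewrite S_INR; lra.
Qed.

Lemma sumR_count {A} (b : A -> bool) c l :
  sumR (fun x => if b x then c else 0) l = c * INR (length (filter b l)).
Proof. now rewrite <- sumR_filter, sumR_const. Qed.

(** Used mainly to enlarge a sum over the divisors of some a <= z to a sum over all of [seq 1 z]. *)
Lemma sumR_incl {A} (f : A -> R) l l' :
  (forall x, 0 <= f x) -> NoDup l -> incl l l' -> sumR f l <= sumR f l'.
Proof.
  intros Hf Hl. revert l'.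
  induction Hl as [|x l Hx Hl IH]; intros l' Hi.
  - apply sumR_nonneg; auto.
  - destruct (in_split x l') as (l1 & l2 & ->); [apply Hi; now left|].
    rewrite sumR_cons, sumR_app, sumR_cons.
    enough (sumR f l <= sumR f (l1 ++ l2)) by (rewrite sumR_app in H; lra).
    apply IH. intros y Hy.
    specialize (Hi y (or_intror Hy)). rewrite in_app_iff in *; simpl in Hi.
    destruct Hi as [|[<-|]]; auto. contradiction.
Qed.

Lemma sumR_ge_term {A} (f : A -> R) x l :
  (forall y, In y l -> 0 <= f y) -> In x l -> f x <= sumR f l.
Proof.
  intros Hf Hx. destruct (in_split x l Hx) as (l1 & l2 & ->).
  rewrite sumR_app, sumR_cons.
  assert (0 <= sumR f l1) by (apply sumR_nonneg; intros; apply Hf, in_app_iff; auto).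
  assert (0 <= sumR f l2) by (apply sumR_nonneg; intros; apply Hf, in_app_iff; right; now right).
  lra.
Qed.

(** * The divisor function *)

Definition dvdb (k n : nat) : bool := Nat.eqb (n mod k) 0.

Definition divs (n : nat) : list nat := filter (fun k => dvdb k n) (seq 1 n).

Lemma ndiv_length n : ndiv n = length (divs n).
Proof. reflexivity. Qed.

Lemma dvdb_spec k n : dvdb k n = true <-> Nat.divide k n.
Proof. unfold dvdb. rewrite Nat.eqb_eq. apply Nat.Lcm0.mod_divide. Qed.

Lemma in_divs k n : In k (divs n) <-> (1 <= n)%nat /\ Nat.divide k n.
Proof.
  unfold divs. rewrite filter_In, in_seq. split.
  - intros [H1 H2]. rewrite dvdb_spec in H2. split; [lia|easy].
  - intros [H1 H2]. assert (k <> 0)%nat by (intros ->; destruct H2; lia).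
    assert (k <= n)%nat by (apply Nat.divide_pos_le; [lia|easy]).
    split; [lia|]. now apply dvdb_spec.
Qed.

Lemma NoDup_divs n : NoDup (divs n).
Proof. apply NoDup_filter, seq_NoDup. Qed.

Lemma NoDup_map_on {A B} (f : A -> B) l :
  (forall x y, In x l -> In y l -> f x = f y -> x = y) -> NoDup l -> NoDup (map f l).
Proof.
  intros Hf Hl. induction Hl as [|x l Hx Hl IH]; simpl; constructor.
  - intros (y & Hy & Hin)%in_map_iff. apply Hx.
    rewrite <- (Hf y x); auto; [now right|now left].
  - apply IH. intros; apply Hf; auto; now right.
Qed.

(** The map sending e to the pair gcd(e, m), e / gcd(e, m) is injective on the divisors of m n. Its
    second entry is coprime to m / gcd(e, m), so by Gauss it divides n. *)
Lemma ndiv_mul m n : (ndiv (m * n) <= ndiv m * ndiv n)%nat.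
Proof.
  destruct (Nat.eq_0_gt_0_cases m) as [->|Hm]; [apply Nat.le_0_l|].
  destruct (Nat.eq_0_gt_0_cases n) as [->|Hn]; [rewrite Nat.mul_0_r; apply Nat.le_0_l|].
  rewrite !ndiv_length, <- length_prod.
  rewrite <- (length_map (fun e => (Nat.gcd e m, (e / Nat.gcd e m)%nat)) (divs (m * n))).
  assert (Hg : forall e, (1 <= Nat.gcd e m)%nat).
  { intros e. assert (Nat.gcd e m <> 0)%nat; [|lia].
    intros H; apply Nat.gcd_eq_0_r in H; lia. }
  assert (He : forall e, (e = Nat.gcd e m * (e / Nat.gcd e m))%nat).
  { intros e. apply Nat.Div0.div_exact, Nat.Lcm0.mod_divide, Nat.gcd_divide_l. }
  apply NoDup_incl_length.
  - apply NoDup_map_on; [|apply NoDup_divs].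
    intros x y _ _ [= H1 H2]. rewrite (He x), (He y), H2, H1. reflexivity.
  - intros p (e & <- & Hin)%in_map_iff. apply in_divs in Hin as [_ Hd].
    apply in_prod; apply in_divs; (split; [lia|]); [apply Nat.gcd_divide_r|].
    destruct (Nat.gcd_divide_r e m) as [c Hc].
    specialize (He e); specialize (Hg e).
    assert (Hcop := Nat.gcd_div_gcd e m (Nat.gcd e m) ltac:(lia) eq_refl).
    apply Nat.gauss with (m / Nat.gcd e m)%nat; [|exact Hcop].
    set (g := Nat.gcd e m) in *. set (f := (e / g)%nat) in *.
    replace (m / g)%nat with c by (rewrite Hc; symmetry; apply Nat.div_mul; lia).
    apply (Nat.mul_divide_cancel_l _ _ g); [lia|].
    rewrite <- He. replace (g * (c * n))%nat with (m * n)%nat by (rewrite Hc; lia).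
    exact Hd.
Qed.

(** * Primes and factorisations *)

Definition nprime (p : nat) : Prop :=
  (2 <= p)%nat /\ forall k, Nat.divide k p -> k = 1%nat \/ k = p.

Definition primeb (p : nat) : bool :=
  andb (2 <=? p)%nat (forallb (fun k => negb (dvdb k p)) (seq 2 (p - 2))).

Lemma primeb_spec p : primeb p = true <-> nprime p.
Proof.
  unfold primeb, nprime. rewrite Bool.andb_true_iff, Nat.leb_le, forallb_forall.
  split; intros [H1 H2]; (split; [easy|]).
  - intros k Hk. assert (k <> 0)%nat by (intros ->; destruct Hk; lia).
    assert (k <= p)%nat by (apply Nat.divide_pos_le; [lia|easy]).
    destruct (Nat.eq_dec k 1); [now left|]. destruct (Nat.eq_dec k p); [now right|].
    assert (Hk' := H2 k ltac:(apply in_seq; lia)).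
    apply dvdb_spec in Hk. rewrite Hk in Hk'. discriminate.
  - intros k Hk. apply in_seq in Hk. apply Bool.negb_true_iff, Bool.not_true_iff_false.
    rewrite dvdb_spec. intros Hd. destruct (H2 k Hd); lia.
Qed.

Lemma nprime_coprime p k : nprime p -> ~ Nat.divide p k -> Nat.gcd p k = 1%nat.
Proof.
  intros [_ Hp] Hk. destruct (Hp (Nat.gcd p k) (Nat.gcd_divide_l _ _)) as [H|H]; [easy|].
  exfalso; apply Hk. rewrite <- H. apply Nat.gcd_divide_r.
Qed.

Lemma divide_dec k n : {Nat.divide k n} + {~ Nat.divide k n}.
Proof.
  destruct (Nat.eq_dec (n mod k) 0) as [H|H]; rewrite Nat.Lcm0.mod_divide in H; auto.
Qed.

Lemma ndiv_prime_pow p e : nprime p -> (ndiv (p ^ e) <= e + 1)%nat.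
Proof.
  intros Hp.
  (* Either p divides k and one factor p cancels on both sides, or k is coprime to p and Gauss
     lowers the exponent. *)
  assert (H : forall e k, Nat.divide k (p ^ e) -> exists i, (i <= e)%nat /\ k = (p ^ i)%nat).
  { clear e. induction e as [|e IH]; intros k Hk.
    - exists 0%nat. split; [lia|]. now apply Nat.divide_1_r.
    - destruct (divide_dec p k) as [Hd|Hd].
      + destruct Hd as [c ->]. destruct (IH c) as (i & Hi & ->).
        * apply (Nat.mul_divide_cancel_r _ _ p); [destruct Hp; lia|].
          replace (p ^ e * p)%nat with (p ^ Datatypes.S e)%nat by (simpl; lia). easy.
        * exists (Datatypes.S i). split; [lia|simpl; lia].
      + destruct (IH k) as (i & Hi & ->); [|exists i; split; [lia|easy]].
        apply Nat.gauss with p; [exact Hk|].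
        rewrite Nat.gcd_comm. now apply nprime_coprime. }
  rewrite ndiv_length, <- (length_seq (e + 1) 0), <- (length_map (Nat.pow p) (seq _ _)).
  apply NoDup_incl_length; [apply NoDup_divs|].
  intros k [_ Hk]%in_divs. destruct (H e k Hk) as (i & Hi & ->).
  apply in_map, in_seq; lia.
Qed.

Definition prodl (l : list nat) : nat := fold_right Nat.mul 1%nat l.

Lemma prodl_app l l' : prodl (l ++ l') = (prodl l * prodl l')%nat.
Proof. induction l as [|x l IH]; simpl; [lia|]. rewrite IH; lia. Qed.

Lemma prodl_pos l : Forall nprime l -> (1 <= prodl l)%nat.
Proof. induction 1 as [|p l [Hp _] _ IH]; simpl; [lia|nia]. Qed.

Lemma in_divide_prodl p l : In p l -> Nat.divide p (prodl l).
Proof.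
  induction l as [|x l IH]; simpl; [easy|]. intros [->|H].
  - apply Nat.divide_factor_l.
  - apply Nat.divide_mul_r; auto.
Qed.

Lemma nprime_divide_prodl p l :
  nprime p -> Forall nprime l -> Nat.divide p (prodl l) -> In p l.
Proof.
  intros Hp Hl. induction Hl as [|x l Hx Hl IH]; simpl; intros H.
  - apply Nat.divide_1_r in H. destruct Hp; lia.
  - destruct (divide_dec p x) as [Hd|Hd].
    + left. destruct (proj2 Hx p Hd) as [->|]; [|easy]. destruct Hp; lia.
    + right. apply IH. apply Nat.gauss with x; [easy|]. now apply nprime_coprime.
Qed.

(** The cofactor of the product of the later primes is still divisible by p, because p is a prime
    different from all of them. *)
Lemma prodl_divide l n :
  NoDup l -> Forall nprime l -> (forall p, In p l -> Nat.divide p n) ->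
  Nat.divide (prodl l) n.
Proof.
  intros Hnd Hl Hdv. induction Hnd as [|p l Hp Hnd IH]; simpl; [apply Nat.divide_1_l|].
  inversion Hl as [|? ? Hpp Hl']; subst.
  destruct IH as [c Hc]; [easy|intros; apply Hdv; now right|].
  assert (Hd : Nat.divide p c).
  { apply Nat.gauss with (prodl l).
    - rewrite Nat.mul_comm, <- Hc. apply Hdv; now left.
    - apply nprime_coprime; [easy|]. intros H; apply Hp. now apply nprime_divide_prodl. }
  destruct Hd as [e ->]. exists e. rewrite Hc; lia.
Qed.

Lemma least_prime_factor n : (2 <= n)%nat ->
  exists p, nprime p /\ Nat.divide p n /\ forall k, (2 <= k)%nat -> Nat.divide k n -> (p <= k)%nat.
Proof.
  intros Hn.
  (* Search upwards for the first divisor that is at least 2. It is prime, since a smaller divisor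
     of it would have been met earlier. *)
  assert (H : forall m, (exists p, nprime p /\ Nat.divide p n /\
       forall k, (2 <= k)%nat -> Nat.divide k n -> (p <= k)%nat) \/
      forall k, (2 <= k <= m)%nat -> ~ Nat.divide k n).
  { induction m as [|m [IH|IH]]; [right; intros; lia|now left|].
    destruct (le_lt_dec 2 (Datatypes.S m)) as [Hm|Hm]; [|right; intros; lia].
    destruct (divide_dec (Datatypes.S m) n) as [Hd|Hd].
    - left. exists (Datatypes.S m).
      assert (Hmin : forall k, (2 <= k)%nat -> Nat.divide k n -> (Datatypes.S m <= k)%nat).
      { intros k Hk Hkd. destruct (le_lt_dec (Datatypes.S m) k); [easy|].
        exfalso; apply (IH k); [lia|easy]. }
      repeat split; auto. intros k Hk.
      assert (k <> 0)%nat by (intros ->; destruct Hk; lia).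
      assert (k <= Datatypes.S m)%nat by (apply Nat.divide_pos_le; [lia|easy]).
      destruct (Nat.eq_dec k 1); [now left|right].
      specialize (Hmin k ltac:(lia) (Nat.divide_trans _ _ _ Hk Hd)). lia.
    - right. intros k Hk. destruct (Nat.eq_dec k (Datatypes.S m)) as [->|]; [easy|].
      apply IH; lia. }
  destruct (H n) as [|Hf]; [easy|]. exfalso. apply (Hf n); [lia|apply Nat.divide_refl].
Qed.

(** Dividing out the least prime factor each time yields the primes in increasing order, so any cut
    of the list separates a smooth part from a rough part. *)
Lemma sorted_factorization n : (1 <= n)%nat ->
  exists l, Forall nprime l /\ StronglySorted le l /\ prodl l = n.
Proof.
  induction n as [n IH] using (well_founded_induction lt_wf). intros Hn.
  destruct (Nat.eq_dec n 1) as [->|Hn1].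
  - exists nil. repeat split; constructor.
  - destruct (least_prime_factor n ltac:(lia)) as (p & Hp & [m Hm] & Hmin).
    assert (Hp2 := proj1 Hp).
    destruct (IH m) as (l & Hl & Hs & Hpl); [nia|nia|].
    exists (p :: l). repeat split.
    + now constructor.
    + constructor; [easy|]. apply Forall_forall. intros x Hx. apply Hmin.
      * rewrite Forall_forall in Hl. apply Hl in Hx. apply Hx.
      * rewrite Hm, <- Hpl. apply Nat.divide_mul_l. now apply in_divide_prodl.
    + simpl. rewrite Hpl; lia.
Qed.

Lemma StronglySorted_middle l1 q l2 : StronglySorted le (l1 ++ q :: l2) ->
  Forall (fun p => (p <= q)%nat) l1 /\ Forall (fun p => (q <= p)%nat) l2.
Proof.
  induction l1 as [|x l1 IH]; simpl; intros H; apply StronglySorted_inv in H as [H1 H2].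
  - split; [constructor|easy].
  - destruct (IH H1) as [H3 H4]. split; [constructor|]; auto.
    rewrite Forall_forall in H2. apply H2, in_app_iff. right; now left.
Qed.

(** Remove factors from the right until the product first drops to z or below; the last factor
    removed is q. *)
Lemma prodl_prefix z l : (1 <= z)%nat -> (z < prodl l)%nat ->
  exists l1 q l2, l = l1 ++ q :: l2 /\ (prodl l1 <= z < prodl l1 * q)%nat.
Proof.
  intros Hz. induction l as [|q l IH] using rev_ind; intros H; [simpl in H; lia|].
  destruct (le_lt_dec (prodl l) z) as [Hl|Hl].
  - exists l, q, nil. split; [easy|]. rewrite prodl_app in H; simpl in H. nia.
  - destruct (IH Hl) as (l1 & r & l2 & -> & Hr).
    exists l1, r, (l2 ++ q :: nil). split; [now rewrite <- app_assoc|easy].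
Qed.

Definition smooth (P a : nat) : Prop :=
  exists l, Forall (fun p => nprime p /\ (p <= P)%nat) l /\ a = prodl l.

Lemma smooth_0 a : smooth 0 a -> a = 1%nat.
Proof.
  intros ([|p l] & Hl & ->); [reflexivity|].
  inversion Hl as [|? ? [[H _] H'] _]; lia.
Qed.

Lemma smooth_pos P a : smooth P a -> (1 <= a)%nat.
Proof.
  intros (l & Hl & ->). apply prodl_pos. eapply Forall_impl; [|exact Hl]. now intros p [].
Qed.

(** Drives inductions on the smoothness bound: a prime contributes one power, and any other integer
    contributes nothing. *)
Lemma smooth_step P a : smooth (Datatypes.S P) a ->
  exists e a', smooth P a' /\ a = (Datatypes.S P ^ e * a')%nat /\
    (e = 0%nat \/ nprime (Datatypes.S P)).
Proof.
  intros (l & Hl & ->). induction Hl as [|p l [Hp Hle] Hl (e & a' & (l' & Hl' & ->) & He & Hor)].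
  - exists 0%nat, 1%nat. repeat split; [exists nil; split; [constructor|reflexivity]|now left].
  - simpl prodl. destruct (Nat.eq_dec p (Datatypes.S P)) as [->|Hne].
    + exists (Datatypes.S e), (prodl l'). repeat split; [now exists l'| |now right].
      rewrite He. simpl. lia.
    + exists e, (p * prodl l')%nat. repeat split; [|rewrite He; lia|easy].
      exists (p :: l'). split; [|reflexivity]. constructor; [split; [easy|lia]|easy].
Qed.

(** * Elementary analytic estimates *)

Definition primes (P : nat) : list nat := filter primeb (seq 1 P).

Lemma in_primes p P : In p (primes P) <-> nprime p /\ (p <= P)%nat.
Proof.
  unfold primes. rewrite filter_In, in_seq, primeb_spec. unfold nprime. intuition lia.
Qed.

Lemma primes_S P : primes (Datatypes.S P) =
  primes P ++ if primeb (Datatypes.S P) then Datatypes.S P :: nil else nil.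
Proof. unfold primes. now rewrite seq_S, filter_app. Qed.

Lemma INR_ge_1 n : (1 <= n)%nat -> 1 <= INR n.
Proof. intros H. now apply (le_INR 1). Qed.

Lemma INR_ge_2 n : (2 <= n)%nat -> 2 <= INR n.
Proof. intros H. now apply (le_INR 2). Qed.

Lemma exp_le x y : x <= y -> exp x <= exp y.
Proof. intros [H| ->]; [left; now apply exp_increasing|lra]. Qed.

Lemma ln_le x y : 0 < x -> x <= y -> ln x <= ln y.
Proof. intros Hx [H| ->]; [left; now apply ln_increasing|lra]. Qed.

Lemma ln_nonneg x : 1 <= x -> 0 <= ln x.
Proof. intros H. rewrite <- ln_1. apply ln_le; lra. Qed.

Lemma ln_ge_half x : 2 <= x -> / 2 <= ln x.
Proof. intros H. assert (ln 2 <= ln x) by (apply ln_le; lra). pose proof ln_lt_2; lra. Qed.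

Lemma ln_prodl l : Forall nprime l -> ln (INR (prodl l)) = sumR (fun p => ln (INR p)) l.
Proof.
  induction 1 as [|p l Hp Hl IH]; simpl prodl.
  - apply ln_1.
  - rewrite sumR_cons, mult_INR, ln_mult, IH; [reflexivity| |].
    + apply lt_0_INR. destruct Hp; lia.
    + apply lt_0_INR. apply prodl_pos in Hl; lia.
Qed.

(** The left side is the logarithm of a product of distinct primes dividing n, and that product
    divides n. *)
Lemma sum_ln_prime_factors n P : (1 <= n)%nat ->
  sumR (fun p => if dvdb p n then ln (INR p) else 0) (primes P) <= ln (INR n).
Proof.
  intros Hn. rewrite <- sumR_filter.
  set (l := filter _ _).
  assert (Hl : Forall nprime l).
  { apply Forall_forall. intros p [Hp _]%filter_In. apply in_primes in Hp. apply Hp. }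
  rewrite <- ln_prodl by easy.
  apply ln_le; [apply lt_0_INR; apply prodl_pos in Hl; lia|].
  apply le_INR, Nat.divide_pos_le; [lia|]. apply prodl_divide; [|easy|].
  - apply NoDup_filter, NoDup_filter, seq_NoDup.
  - intros p [_ Hp]%filter_In. now apply dvdb_spec.
Qed.

Lemma count_multiples p P : (1 <= p)%nat ->
  (P / p <= length (filter (dvdb p) (seq 1 P)))%nat.
Proof.
  intros Hp. rewrite <- (length_seq (P / p) 1), <- (length_map (Nat.mul p) (seq 1 (P / p))).
  apply NoDup_incl_length.
  - apply NoDup_map_on; [|apply seq_NoDup]. intros; nia.
  - intros k (i & <- & Hi)%in_map_iff. apply in_seq in Hi.
    apply filter_In. split; [|apply dvdb_spec, Nat.divide_factor_l].
    apply in_seq. pose proof (Nat.Div0.mul_div_le P p). nia.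
Qed.

(* Chebyshev's comparison of P! with the multiples of each prime. *)
Lemma sum_ln_div_primes P : (1 <= P)%nat ->
  sumR (fun p => ln (INR p) / INR p) (primes P) <= 2 * ln (INR P).
Proof.
  intros HP. assert (HP' := INR_ge_1 P HP).
  assert (H1 : sumR (fun n => sumR (fun p => if dvdb p n then ln (INR p) else 0) (primes P)) (seq 1 P)
     <= sumR (fun _ => ln (INR P)) (seq 1 P)).
  { apply sumR_le. intros n Hn%in_seq.
    eapply Rle_trans; [apply sum_ln_prime_factors; lia|].
    apply ln_le; [apply lt_0_INR; lia|apply le_INR; lia]. }
  rewrite sumR_const, length_seq, sumR_swap in H1.
  assert (H2 : sumR (fun p => (INR P / 2) * (ln (INR p) / INR p)) (primes P)
    <= sumR (fun p => sumR (fun n => if dvdb p n then ln (INR p) else 0) (seq 1 P)) (primes P)).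
  { apply sumR_le. intros p [[Hp _] HpP]%in_primes.
    rewrite (sumR_count (dvdb p)).
    assert (Hp2 := INR_ge_2 p Hp). assert (Hln := ln_nonneg (INR p) ltac:(lra)).
    assert (Hc := count_multiples p P ltac:(lia)).
    (* As p <= P, the quotient is at least 1, so rounding it down loses at most a factor 2. This is
       the 2 in the final bound. *)
    assert (Hd : (P <= 2 * p * (P / p))%nat).
    { assert (1 <= P / p)%nat by (apply Nat.div_le_lower_bound; lia).
      pose proof (Nat.mul_succ_div_gt P p ltac:(lia)). nia. }
    replace (INR P / 2 * (ln (INR p) / INR p)) with (ln (INR p) * (INR P / (2 * INR p)))
      by (field; lra).
    apply Rmult_le_compat_l; [easy|].
    apply Rmult_le_reg_r with (2 * INR p); [lra|].
    replace (INR P / (2 * INR p) * (2 * INR p)) with (INR P) by (field; lra).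
    eapply Rle_trans; [apply le_INR, Hd|]. rewrite !mult_INR.
    apply le_INR in Hc. change (INR 2) with 2. nra. }
  rewrite sumR_scal in H2.
  apply Rmult_le_reg_l with (INR P / 2); [lra|].
  lra.
Qed.

(** * Harmonic sums and sums of reciprocal least common multiples *)

Definition harm (z : nat) : R := sumR (fun v => / INR v) (seq 1 z).

Lemma harm_le z : (1 <= z)%nat -> harm z <= 1 + ln (INR z).
Proof.
  intros Hz. induction Hz as [|z Hz IH]; unfold harm in *.
  - unfold sumR; simpl. rewrite ln_1. lra.
  - rewrite seq_S, sumR_app, sumR_cons, sumR_nil.
    change (1 + z)%nat with (Datatypes.S z).
    assert (Hz' := INR_ge_1 z Hz).
    enough (/ INR (Datatypes.S z) <= ln (INR (Datatypes.S z)) - ln (INR z)) by lra.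
    rewrite S_INR.
    (* This is 1 + t <= exp t at t = -1/(z + 1). *)
    assert (H : ln (INR z / (INR z + 1)) <= - / (INR z + 1)).
    { rewrite <- (ln_exp (- / (INR z + 1))). apply ln_le.
      - apply Rdiv_lt_0_compat; lra.
      - eapply Rle_trans; [|apply exp_ineq1_le]. right; field; lra. }
    unfold Rdiv in H. rewrite ln_mult, ln_Rinv in H; try lra. apply Rinv_0_lt_compat; lra.
Qed.

Lemma harm_nonneg z : 0 <= harm z.
Proof.
  apply sumR_nonneg. intros v Hv%in_seq. left. apply Rinv_0_lt_compat, lt_0_INR. lia.
Qed.

Lemma sum_multiples_le_harm e z : (1 <= e)%nat ->
  sumR (fun v => if dvdb e v then INR e / INR v else 0) (seq 1 z) <= harm z.
Proof.
  intros He. rewrite <- sumR_filter.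
  rewrite (sumR_ext _ (fun v => / INR (v / e))).
  - rewrite <- (sumR_map (fun v => (v / e)%nat) (fun v => / INR v)).
    (* [sumR_incl] wants a summand that is nonnegative at every natural number; [Rmax 0] secures
       this at 0 as well. *)
    unfold harm. rewrite !(sumR_ext (fun v => / INR v) (fun v => Rmax 0 (/ INR v))).
    + apply sumR_incl; [intros; apply Rmax_l| |].
      * apply NoDup_map_on; [|apply NoDup_filter, seq_NoDup].
        intros x y [_ Hx]%filter_In [_ Hy]%filter_In Hxy.
        apply dvdb_spec, Nat.Lcm0.mod_divide, Nat.Div0.div_exact in Hx.
        apply dvdb_spec, Nat.Lcm0.mod_divide, Nat.Div0.div_exact in Hy. congruence.
      * intros k (v & <- & [Hv Hd]%filter_In)%in_map_iff.
        apply dvdb_spec in Hd as [c ->]. apply in_seq in Hv. apply in_seq.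
        rewrite Nat.div_mul by lia. nia.
    + intros v Hv%in_seq. rewrite Rmax_right; [easy|].
      left; apply Rinv_0_lt_compat, lt_0_INR; lia.
    + intros k (v & <- & [Hv Hd]%filter_In)%in_map_iff.
      apply dvdb_spec in Hd as [c ->]. apply in_seq in Hv.
      rewrite Nat.div_mul by lia. rewrite Rmax_right; [easy|].
      left; apply Rinv_0_lt_compat, lt_0_INR; nia.
  - intros v [Hv Hd]%filter_In. apply dvdb_spec in Hd as [c ->]. apply in_seq in Hv.
    rewrite Nat.div_mul, mult_INR by lia.
    assert (INR c <> 0) by (apply not_0_INR; nia).
    assert (INR e <> 0) by (apply not_0_INR; nia).
    field; auto.
Qed.

(** Since 1 / lcm(u, v) = gcd(u, v) / (u v), and gcd(u, v) is at most the sum of all common divisors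
    e of u and v, swapping the sums leaves at most [harm z] for each e dividing u. *)
Lemma sum_inv_lcm_le u z : (1 <= u)%nat ->
  sumR (fun v => / INR (Nat.lcm u v)) (seq 1 z) <= INR (ndiv u) / INR u * harm z.
Proof.
  intros Hu. assert (Hu' := INR_ge_1 u Hu).
  apply Rle_trans with (sumR (fun v => / INR u *
    sumR (fun e => if dvdb e v then INR e / INR v else 0) (divs u)) (seq 1 z)).
  - apply sumR_le. intros v Hv%in_seq.
    assert (Hv' := INR_ge_1 v ltac:(lia)).
    assert (Hlg : (Nat.lcm u v * Nat.gcd u v = u * v)%nat).
    { unfold Nat.lcm. rewrite <- Nat.mul_assoc, (Nat.mul_comm (v / _)). f_equal. symmetry.
      apply Nat.Div0.div_exact, Nat.Lcm0.mod_divide, Nat.gcd_divide_r. }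
    assert (Hg : (1 <= Nat.gcd u v)%nat) by nia.
    assert (Hl : (1 <= Nat.lcm u v)%nat) by nia.
    apply INR_ge_1 in Hg, Hl. apply (f_equal INR) in Hlg. rewrite !mult_INR in Hlg.
    apply Rle_trans with (/ INR u * (INR (Nat.gcd u v) / INR v)).
    + right. apply Rmult_eq_reg_r with (INR u * INR v); [|nra].
      rewrite <- Hlg at 1. field; lra.
    + apply Rmult_le_compat_l; [left; apply Rinv_0_lt_compat; lra|].
      assert (Hd : dvdb (Nat.gcd u v) v = true) by apply dvdb_spec, Nat.gcd_divide_r.
      set (F := fun e => if dvdb e v then INR e / INR v else 0).
      replace (INR (Nat.gcd u v) / INR v) with (F (Nat.gcd u v)) by (unfold F; now rewrite Hd).
      apply sumR_ge_term.
      * intros e _. unfold F. destruct (dvdb e v); [|lra].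
        apply Rmult_le_pos; [apply pos_INR|left; apply Rinv_0_lt_compat; lra].
      * apply in_divs. split; [easy|apply Nat.gcd_divide_l].
  - rewrite sumR_scal, sumR_swap.
    replace (INR (ndiv u) / INR u * harm z) with (/ INR u * (harm z * INR (ndiv u)))
      by (field; lra).
    apply Rmult_le_compat_l; [left; apply Rinv_0_lt_compat; lra|].
    rewrite ndiv_length, <- sumR_const.
    apply sumR_le. intros e [_ He]%in_divs. apply sum_multiples_le_harm.
    destruct e; [destruct He; lia|lia].
Qed.

Lemma Rpower_pos x y : 0 < Rpower x y.
Proof. apply exp_pos. Qed.

Lemma Rpower_ge_1 x y : 1 <= x -> 0 <= y -> 1 <= Rpower x y.
Proof.
  intros Hx Hy. rewrite <- exp_0. unfold Rpower. apply exp_le.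
  apply Rmult_le_pos; [easy|now apply ln_nonneg].
Qed.

Lemma Rpower_pow_base x e y : 0 < x -> Rpower (x ^ e) y = Rpower x y ^ e.
Proof.
  intros Hx. rewrite <- !Rpower_pow; [|apply Rpower_pos|easy].
  rewrite !Rpower_mult. f_equal; lra.
Qed.

(** * Bounds for the divisor function *)

Lemma ndiv_prime p : nprime p -> (ndiv p <= 2)%nat.
Proof. intros Hp. rewrite <- (Nat.pow_1_r p). now apply (ndiv_prime_pow p 1). Qed.

Lemma ndiv_mul_INR m n : INR (ndiv (m * n)) <= INR (ndiv m) * INR (ndiv n).
Proof. rewrite <- mult_INR. apply le_INR, ndiv_mul. Qed.

(** Each prime up to P costs a constant factor, so C may depend on P and [eps] but not on the
    exponents. *)
Lemma ndiv_smooth_le eps P : 0 < eps ->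
  exists C, 1 <= C /\ forall a, smooth P a -> INR (ndiv a) <= C * Rpower (INR a) eps.
Proof.
  intros Heps. induction P as [|P (C & HC & IH)].
  - exists 1. split; [lra|]. intros a ->%smooth_0.
    change (INR (ndiv 1)) with 1. pose proof (Rpower_ge_1 (INR 1) eps ltac:(simpl; lra)). lra.
  (* Chosen so that e + 1 <= c (1 + e eps / 2). As ln p >= 1/2, the bracket is at most p^(e eps). *)
  - set (c := 1 + 2 / eps).
    assert (Hc : 0 < 2 / eps) by (apply Rdiv_lt_0_compat; lra).
    exists (c * C). split; [unfold c; nra|].
    intros a Ha. assert (Ha1 := smooth_pos _ _ Ha).
    destruct (smooth_step P a Ha) as (e & a' & Ha' & -> & He).
    assert (Ha'1 := smooth_pos _ _ Ha').
    specialize (IH a' Ha').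
    assert (Hpow : INR (ndiv (Datatypes.S P ^ e)) <= c * Rpower (INR (Datatypes.S P ^ e)) eps).
    { destruct He as [->|Hp].
      - simpl Nat.pow. change (INR (ndiv 1)) with 1.
        pose proof (Rpower_ge_1 (INR 1) eps ltac:(simpl; lra)). unfold c; nra.
      - apply Rle_trans with (INR (e + 1)); [now apply le_INR, ndiv_prime_pow|].
        assert (Hp2 := INR_ge_2 _ (proj1 Hp)).
        rewrite pow_INR, Rpower_pow_base by lra.
        assert (Hl := ln_ge_half _ Hp2).
        apply Rle_trans with (c * (1 + INR e * (eps / 2))).
        + rewrite plus_INR; change (INR 1) with 1. pose proof (pos_INR e).
          replace (c * (1 + INR e * (eps / 2)))
            with (1 + 2 / eps + INR e + INR e * (eps / 2)) by (unfold c; field; lra).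
          nra.
        + apply Rmult_le_compat_l; [unfold c; lra|].
          rewrite <- Rpower_pow by apply Rpower_pos. rewrite Rpower_mult.
          eapply Rle_trans; [|apply exp_ineq1_le].
          pose proof (pos_INR e). assert (0 <= INR e * eps) by nra. nra. }
    eapply Rle_trans; [apply ndiv_mul_INR|].
    rewrite mult_INR, <- Rpower_mult_distr; [|apply lt_0_INR; nia|apply lt_0_INR; lia].
    replace (c * C * (Rpower (INR (Datatypes.S P ^ e)) eps * Rpower (INR a') eps))
      with (c * Rpower (INR (Datatypes.S P ^ e)) eps * (C * Rpower (INR a') eps)) by ring.
    apply Rmult_le_compat; auto using pos_INR.
Qed.

(** Each prime factor satisfies d(p) <= 2 <= p^eps, so submultiplicativity gives the bound with
    constant 1. *)
Lemma ndiv_prodl_le_Rpower (Q : nat -> Prop) eps l :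
  (forall p, Q p -> nprime p /\ 2 <= Rpower (INR p) eps) -> Forall Q l ->
  INR (ndiv (prodl l)) <= Rpower (INR (prodl l)) eps.
Proof.
  intros HQ Hl. induction Hl as [|p l Hp Hl IH]; simpl prodl.
  - change (INR (ndiv 1)) with 1. unfold Rpower. simpl INR. rewrite ln_1, Rmult_0_r, exp_0. lra.
  - destruct (HQ p Hp) as [Hpp Hp2]. assert (Hp1 := proj1 Hpp).
    assert (Hpos : (1 <= prodl l)%nat).
    { apply prodl_pos. eapply Forall_impl; [|exact Hl]. apply HQ. }
    eapply Rle_trans; [apply ndiv_mul_INR|].
    rewrite mult_INR, <- Rpower_mult_distr; [|apply lt_0_INR; lia|apply lt_0_INR; lia].
    apply Rmult_le_compat; auto using pos_INR.
    assert (H := ndiv_prime p Hpp). apply le_INR in H. simpl in H. lra.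
Qed.

Lemma ndiv_le_Rpower eps : 0 < eps ->
  exists C, 1 <= C /\ forall l, Forall nprime l ->
    INR (ndiv (prodl l)) <= C * Rpower (INR (prodl l)) eps.
Proof.
  (* Primes p >= exp(1 / eps) satisfy p^eps >= 1 + eps ln p >= 2 and cost no constant. The smaller
     ones go to [ndiv_smooth_le]. *)
  intros Heps. destruct (INR_archimed 1 (exp (1 / eps)) ltac:(lra)) as [P HP].
  destruct (ndiv_smooth_le eps P Heps) as (C & HC & HS).
  exists C. split; [easy|]. intros l Hl.
  assert (H : exists a l', smooth P a /\ Forall (fun p => nprime p /\ (P <= p)%nat) l' /\
     prodl l = (a * prodl l')%nat).
  { induction Hl as [|p l Hp Hl (a & l' & (l1 & Hl1 & ->) & Hl' & He)].
    - exists 1%nat, nil. split; [exists nil|]; repeat split; constructor.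
    - simpl prodl. destruct (le_lt_dec p P).
      + exists (p * prodl l1)%nat, l'. split; [exists (p :: l1); split; auto|].
        split; [easy|]. rewrite He; lia.
      + exists (prodl l1), (p :: l'). split; [now exists l1|].
        split; [constructor; [split; [easy|lia]|easy]|]. rewrite He; simpl; lia. }
  destruct H as (a & l' & Ha & Hl' & ->).
  assert (Ha1 := smooth_pos _ _ Ha).
  assert (Hl1 : (1 <= prodl l')%nat).
  { apply prodl_pos. eapply Forall_impl; [|exact Hl']. now intros ? []. }
  eapply Rle_trans; [apply ndiv_mul_INR|].
  rewrite mult_INR, <- Rpower_mult_distr, <- Rmult_assoc; [|apply lt_0_INR; lia|apply lt_0_INR; lia].
  apply Rmult_le_compat; auto using pos_INR.
  apply ndiv_prodl_le_Rpower with (fun p => nprime p /\ (P <= p)%nat); [|easy].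
  intros p [Hp HpP]. split; [easy|].
  apply le_INR in HpP.
  assert (He : exp (1 / eps) <= INR p) by lra.
  apply ln_le in He; [|apply exp_pos]. rewrite ln_exp in He.
  unfold Rpower. apply Rle_trans with (1 + eps * ln (INR p)); [|apply exp_ineq1_le].
  enough (eps * (1 / eps) <= eps * ln (INR p)) by (replace (eps * (1 / eps)) with 1 in H by (field; lra); lra).
  apply Rmult_le_compat_l; lra.
Qed.

(* The cap 1/32 keeps the Rankin exponent 16 * eps q at most 1/2. *)
Definition eps (q : nat) : R := Rmin (1 / 32) (1 / ln (INR q)).

Lemma eps_pos q : (2 <= q)%nat -> 0 < eps q.
Proof.
  intros Hq. unfold eps. apply Rmin_glb_lt; [lra|].
  apply Rdiv_lt_0_compat; [lra|]. pose proof (ln_ge_half _ (INR_ge_2 q Hq)). lra.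
Qed.

(** The point is that C is uniform in q. If [eps q] is 1/32, the general divisor bound applies. If
    it is 1 / ln q, every prime p >= q has p^(eps q) >= 1 + ln p / ln q >= 2. *)
Lemma ndiv_rough_le :
  exists C, 1 <= C /\ forall q l, (2 <= q)%nat -> Forall (fun p => nprime p /\ (q <= p)%nat) l ->
    INR (ndiv (prodl l)) <= C * Rpower (INR (prodl l)) (eps q).
Proof.
  destruct (ndiv_le_Rpower (1 / 32) ltac:(lra)) as (C & HC & H).
  exists C. split; [easy|]. intros q l Hq Hl.
  assert (Hl2 := ln_ge_half _ (INR_ge_2 q Hq)).
  unfold eps. apply Rmin_case.
  - apply H. eapply Forall_impl; [|exact Hl]. now intros ? [].
  - eapply Rle_trans; [apply ndiv_prodl_le_Rpower with (eps := 1 / ln (INR q)) (2 := Hl)|].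
    + intros p [Hp Hqp]. split; [easy|]. apply le_INR in Hqp.
      assert (Hln : ln (INR q) <= ln (INR p)) by (apply ln_le; [apply lt_0_INR; lia|easy]).
      unfold Rpower. apply Rle_trans with (1 + 1 / ln (INR q) * ln (INR p)); [|apply exp_ineq1_le].
      enough (1 / ln (INR q) * ln (INR q) <= 1 / ln (INR q) * ln (INR p))
        by (replace (1 / ln (INR q) * ln (INR q)) with 1 in H0 by (field; lra); lra).
      apply Rmult_le_compat_l; [|easy]. left. apply Rdiv_lt_0_compat; lra.
    + pose proof (Rpower_pos (INR (prodl l)) (1 / ln (INR q))). nra.
Qed.

(** * Weighted divisor sums *)

(** Pairs of a weight and a divisor. A divisor may occur repeatedly, its weights then adding up, so
    no collisions among the lcm's need be tracked. *)
Definition wlist : Type := list (R * nat).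

Definition wdiv (L : wlist) (n : nat) : R :=
  sumR (fun x => if dvdb (snd x) n then fst x else 0) L.

Definition wmass (L : wlist) : R := sumR (fun x => fst x / INR (snd x)) L.

(** The mass with an extra d(u), the price paid in [sum_inv_lcm_le] for summing 1 / lcm(u, v) over
    v. *)
Definition wcost (L : wlist) : R :=
  sumR (fun x => fst x * (INR (ndiv (snd x)) / INR (snd x))) L.

Definition admissible (L : wlist) : Prop :=
  forall x, In x L -> 0 <= fst x /\ (1 <= snd x)%nat.

Lemma sum_arith_geom_le r J : 0 <= r <= 3 / 4 ->
  sumR (fun i => (INR i + 2) * r ^ i) (seq 0 J) <= 20.
Proof.
  intros Hr.
  apply Rle_trans with (sumR (fun i => (INR i + 2) * (3 / 4) ^ i) (seq 0 J)).
  - apply sumR_le. intros i _. apply Rmult_le_compat_l; [pose proof (pos_INR i); lra|].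
    apply pow_incr; lra.
  (* Closed form of the partial sums at r = 3/4; the infinite series equals 12 + 8 = 20. *)
  - assert (H : sumR (fun i => (INR i + 2) * (3 / 4) ^ i) (seq 0 J)
                = 20 - (4 * INR J + 20) * (3 / 4) ^ J).
    { induction J as [|J IH]; [unfold sumR; simpl; lra|].
      rewrite seq_S, sumR_app, IH, sumR_cons, sumR_nil, S_INR. simpl. field. }
    rewrite H. pose proof (pos_INR J). pose proof (pow_lt (3 / 4) J ltac:(lra)). nra.
Qed.

(* Values at prime powers of the multiplicative function g with
   sum_(u | a) g(u) = a^sg. *)
Definition gpow (sg : R) (p j : nat) : R :=
  match j with
  | O => 1
  | Datatypes.S i => (Rpower (INR p) sg - 1) * Rpower (INR p) sg ^ i
  end.

Lemma gpow_nonneg sg p j : 0 <= sg -> (1 <= p)%nat -> 0 <= gpow sg p j.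
Proof.
  intros Hs Hp. assert (H := Rpower_ge_1 (INR p) sg (INR_ge_1 p Hp) Hs).
  destruct j; simpl; [lra|]. apply Rmult_le_pos; [lra|]. apply pow_le; lra.
Qed.

Lemma sum_gpow sg p e : sumR (gpow sg p) (seq 0 (Datatypes.S e)) = Rpower (INR p) sg ^ e.
Proof.
  induction e as [|e IH].
  - unfold sumR; simpl. lra.
  - rewrite seq_S, sumR_app, IH, sumR_cons, sumR_nil. simpl. ring.
Qed.

(** With t = p^sg, the term j = 0 is 1 and the others sum to (t - 1) / p times an
    arithmetic-geometric sum of ratio t / p, at most 20. Then 1 + y <= exp y puts the factor in a
    form that multiplies over primes. *)
Lemma sum_gpow_cost sg p J : 0 <= sg <= 1 / 2 -> (2 <= p)%nat ->
  sumR (fun j => gpow sg p j * ((INR j + 1) / INR p ^ j)) (seq 0 (Datatypes.S J))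
  <= exp (20 * ((Rpower (INR p) sg - 1) / INR p)).
Proof.
  intros Hs Hp. assert (Hp2 := INR_ge_2 p Hp).
  assert (H1 := Rpower_ge_1 (INR p) sg ltac:(lra) ltac:(lra)).
  set (t := Rpower (INR p) sg) in *.
  (* Because sg <= 1/2, the ratio is at most 1 / sqrt p <= 1 / sqrt 2 < 3/4. *)
  assert (Hr : 0 <= t / INR p <= 3 / 4).
  { split; [apply Rmult_le_pos; [lra|left; apply Rinv_0_lt_compat; lra]|].
    assert (Ht : t <= sqrt (INR p)).
    { rewrite <- Rpower_sqrt by lra. apply Rle_Rpower; lra. }
    assert (Hsq := sqrt_sqrt (INR p) ltac:(lra)).
    assert (Hsp := sqrt_pos (INR p)).
    apply Rmult_le_reg_r with (INR p); [lra|].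
    replace (t / INR p * INR p) with t by (field; lra). nra. }
  simpl seq. rewrite sumR_cons, <- seq_shift, sumR_map.
  rewrite (sumR_ext _ (fun i => (t - 1) / INR p * ((INR i + 2) * (t / INR p) ^ i))).
  - rewrite sumR_scal. simpl gpow.
    assert (Hsum := sum_arith_geom_le (t / INR p) J Hr).
    assert (0 <= (t - 1) / INR p)
      by (apply Rmult_le_pos; [lra|left; apply Rinv_0_lt_compat; lra]).
    eapply Rle_trans; [|apply exp_ineq1_le]. simpl. nra.
  - intros i _. simpl gpow. fold t. rewrite S_INR. simpl pow.
    replace ((t / INR p) ^ i) with (t ^ i * / INR p ^ i) by (unfold Rdiv; now rewrite Rpow_mult_distr, pow_inv).
    field.
    split; [apply pow_nonzero|]; lra.
Qed.

(* Represents a^sg, for a <= z with all prime factors at most P, as a sum over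
   divisors; z only truncates the exponents. *)
Fixpoint rankin (sg : R) (z P : nat) : wlist :=
  match P with
  | O => (1, 1%nat) :: nil
  | Datatypes.S P' =>
      if primeb P then
        flat_map (fun j => map (fun x => (fst x * gpow sg P j, (snd x * P ^ j)%nat))
                               (rankin sg z P'))
                 (seq 0 (Datatypes.S z))
      else rankin sg z P'
  end.

Lemma rankin_admissible sg z P : 0 <= sg -> admissible (rankin sg z P).
Proof.
  intros Hs. induction P as [|P IH]; intros x Hx; cbn [rankin] in Hx.
  - destruct Hx as [<-|[]]. simpl. split; [lra|lia].
  - destruct (primeb (Datatypes.S P)); [|now apply IH].
    apply in_flat_map in Hx as (j & _ & (y & <- & Hy)%in_map_iff).
    destruct (IH y Hy) as [H1 H2]. cbn [fst snd]. split.
    + apply Rmult_le_pos; [easy|apply gpow_nonneg; [easy|lia]].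
    + assert (Datatypes.S P ^ j <> 0)%nat by (apply Nat.pow_nonzero; lia). nia.
Qed.

(** If p^e is the power of p split off from a, the exponents j <= e alone give p^(sg e) by
    telescoping, and the terms with j > e are nonnegative. *)
Lemma rankin_ge sg z P a : 0 <= sg -> smooth P a -> (a <= z)%nat ->
  Rpower (INR a) sg <= wdiv (rankin sg z P) a.
Proof.
  intros Hs. revert a. induction P as [|P IH]; intros a Ha Haz.
  - apply smooth_0 in Ha as ->. unfold wdiv, rankin. rewrite sumR_cons, sumR_nil. simpl.
    unfold Rpower. rewrite ln_1, Rmult_0_r, exp_0. lra.
  - destruct (smooth_step P a Ha) as (e & a' & Ha' & -> & He).
    assert (Ha1 := smooth_pos _ _ Ha').
    cbn [rankin]. destruct (primeb (Datatypes.S P)) eqn:Hpb.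
    + apply primeb_spec in Hpb. assert (Hp2 := proj1 Hpb).
      set (p := Datatypes.S P) in *.
      (* The truncation is harmless: e < p^e <= a <= z, so the exponents 0, ..., z include e. *)
      assert (Hpe : (e < p ^ e)%nat) by (apply Nat.pow_gt_lin_r; lia).
      assert (Hez : (e <= z)%nat) by nia.
      assert (Ha'z : (a' <= z)%nat) by nia.
      specialize (IH a' Ha' Ha'z).
      rewrite mult_INR, pow_INR, <- Rpower_mult_distr;
        [|apply pow_lt, lt_0_INR; lia|apply lt_0_INR; lia].
      rewrite Rpower_pow_base by (apply lt_0_INR; lia).
      rewrite <- sum_gpow. unfold wdiv. rewrite sumR_flat_map.
      replace (Datatypes.S z) with (Datatypes.S e + (z - e))%nat by lia.
      rewrite seq_app, sumR_app.
      assert (Hadm := rankin_admissible sg z P Hs).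
      match goal with |- _ <= _ + sumR ?f ?l => assert (Hpos : 0 <= sumR f l) end.
      { apply sumR_nonneg. intros j _. rewrite sumR_map. apply sumR_nonneg. intros x Hx.
        cbn [fst snd]. destruct (dvdb _ _); [|lra].
        apply Rmult_le_pos; [now apply Hadm|apply gpow_nonneg; [easy|lia]]. }
      match goal with |- _ <= ?s + _ => enough (H : sumR (gpow sg p) (seq 0 (Datatypes.S e)) *
         Rpower (INR a') sg <= s) by lra end.
      rewrite Rmult_comm, <- sumR_scal. apply sumR_le. intros j Hj%in_seq.
      rewrite sumR_map. cbn [fst snd]. rewrite Rmult_comm.
      apply Rle_trans with (gpow sg p j * wdiv (rankin sg z P) a').
      { apply Rmult_le_compat_l; [apply gpow_nonneg; [easy|lia]|easy]. }
      unfold wdiv. rewrite <- sumR_scal. apply sumR_le. intros x Hx.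
      destruct (Hadm x Hx) as [H1 H2]. assert (Hg := gpow_nonneg sg p j Hs ltac:(lia)).
      destruct (dvdb (snd x) a') eqn:Hd.
      * apply dvdb_spec in Hd.
        replace (dvdb (snd x * p ^ j) (p ^ e * a')) with true; [lra|].
        symmetry. apply dvdb_spec. rewrite (Nat.mul_comm (p ^ e)).
        apply Nat.mul_divide_mono_r with (p := (p ^ j)%nat) in Hd.
        eapply Nat.divide_trans; [exact Hd|].
        replace e with (j + (e - j))%nat by lia. rewrite Nat.pow_add_r.
        exists (p ^ (e - j))%nat. lia.
      * rewrite Rmult_0_r. destruct (dvdb (_ * _) _); [now apply Rmult_le_pos|lra].
    + destruct He as [->|He]; [|apply primeb_spec in He; congruence].
      simpl Nat.pow in *. rewrite Nat.mul_1_l in *. now apply IH.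
Qed.

(** An Euler product bound: d(u p^j) <= d(u) (j + 1) splits off one factor per prime, and
    [sum_gpow_cost] bounds it by an exponential. *)
Lemma rankin_cost sg z P : 0 <= sg <= 1 / 2 ->
  wcost (rankin sg z P) <= exp (20 * sumR (fun p => (Rpower (INR p) sg - 1) / INR p) (primes P)).
Proof.
  intros Hs. induction P as [|P IH].
  - unfold wcost, rankin. rewrite sumR_cons, !sumR_nil. cbn [fst snd].
    change (INR (ndiv 1)) with 1. simpl. rewrite Rmult_0_r, exp_0. lra.
  - cbn [rankin]. rewrite primes_S, sumR_app.
    destruct (primeb (Datatypes.S P)) eqn:Hpb; [|now rewrite sumR_nil, Rplus_0_r].
    apply primeb_spec in Hpb. assert (Hp2 := proj1 Hpb).
    rewrite sumR_cons, sumR_nil, Rplus_0_r, Rmult_plus_distr_l, exp_plus, Rmult_comm.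
    set (p := Datatypes.S P) in *.
    assert (Hp2' := INR_ge_2 p Hp2).
    assert (Hadm := rankin_admissible sg z P ltac:(lra)).
    unfold wcost at 1. rewrite sumR_flat_map.
    apply Rle_trans with (sumR (fun j => wcost (rankin sg z P) *
      (gpow sg p j * ((INR j + 1) / INR p ^ j))) (seq 0 (Datatypes.S z))).
    + apply sumR_le. intros j _. rewrite sumR_map, Rmult_comm.
      unfold wcost. rewrite <- sumR_scal. apply sumR_le. intros x Hx. cbn [fst snd].
      destruct (Hadm x Hx) as [H1 H2]. assert (Hg := gpow_nonneg sg p j ltac:(lra) ltac:(lia)).
      assert (Hu := INR_ge_1 _ H2).
      assert (Hpj : 0 < INR p ^ j) by (apply pow_lt; lra).
      assert (Hn : INR (ndiv (snd x * p ^ j)) <= INR (ndiv (snd x)) * (INR j + 1)).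
      { eapply Rle_trans; [apply ndiv_mul_INR|]. apply Rmult_le_compat_l; [apply pos_INR|].
        rewrite <- S_INR. apply le_INR. rewrite <- Nat.add_1_r. now apply ndiv_prime_pow. }
      rewrite mult_INR, pow_INR.
      replace (gpow sg p j * ((INR j + 1) / INR p ^ j) *
               (fst x * (INR (ndiv (snd x)) / INR (snd x))))
        with (fst x * gpow sg p j *
              ((INR (ndiv (snd x)) * (INR j + 1)) / (INR (snd x) * INR p ^ j))) by (field; lra).
      apply Rmult_le_compat_l; [nra|].
      apply Rmult_le_compat_r; [left; apply Rinv_0_lt_compat; nra|easy].
    + rewrite sumR_scal. rewrite (Rmult_comm (exp _)). apply Rmult_le_compat.
      * apply sumR_nonneg. intros x Hx. destruct (Hadm x Hx) as [H1 H2].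
        apply Rmult_le_pos; [easy|]. apply Rmult_le_pos; [apply pos_INR|].
        left; apply Rinv_0_lt_compat, lt_0_INR; lia.
      * apply sumR_nonneg. intros j _. apply Rmult_le_pos; [apply gpow_nonneg; [lra|lia]|].
        apply Rmult_le_pos; [pose proof (pos_INR j); lra|].
        left; apply Rinv_0_lt_compat, pow_lt; lra.
      * easy.
      * apply sum_gpow_cost; [easy|lia].
Qed.

Lemma exp_minus_1_le y : exp y - 1 <= y * exp y.
Proof.
  assert (H := exp_ineq1_le (- y)). rewrite exp_Ropp in H.
  assert (He := exp_pos y).
  apply Rmult_le_compat_r with (r := exp y) in H; [|lra].
  rewrite Rinv_l in H by lra. lra.
Qed.

(** For p <= q one has 16 eps ln p <= 16, hence p^(16 eps) - 1 <= 16 eps e^16 ln p. Summing ln p / p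
    gives at most 2 ln q, which eps ln q <= 1 absorbs. The constant is 640 = 20 · 16 · 2, uniformly
    in z and q. *)
Lemma rankin_cost_eps z q : (2 <= q)%nat ->
  wcost (rankin (16 * eps q) z q) <= exp (640 * exp 16).
Proof.
  intros Hq. assert (He := eps_pos q Hq). assert (Hq2 := INR_ge_2 q Hq).
  assert (Hlq := ln_ge_half _ Hq2).
  assert (He1 : eps q <= 1 / 32) by apply Rmin_l.
  assert (He2 : eps q * ln (INR q) <= 1).
  { apply Rle_trans with (1 / ln (INR q) * ln (INR q)).
    - apply Rmult_le_compat_r; [lra|apply Rmin_r].
    - right; field; lra. }
  eapply Rle_trans; [apply rankin_cost; lra|]. apply exp_le.
  apply Rle_trans with (20 * sumR (fun p => 16 * eps q * exp 16 * (ln (INR p) / INR p)) (primes q)).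
  - apply Rmult_le_compat_l; [lra|]. apply sumR_le. intros p [[Hp _] Hpq]%in_primes.
    assert (Hp2 := INR_ge_2 p Hp). assert (Hlp := ln_ge_half _ Hp2).
    assert (Hlpq : ln (INR p) <= ln (INR q)) by (apply ln_le; [lra|now apply le_INR]).
    unfold Rdiv. rewrite <- Rmult_assoc.
    apply Rmult_le_compat_r; [left; apply Rinv_0_lt_compat; lra|].
    unfold Rpower. eapply Rle_trans; [apply exp_minus_1_le|].
    apply Rle_trans with (16 * eps q * ln (INR p) * exp 16); [|right; ring].
    apply Rmult_le_compat_l; [nra|]. apply exp_le. nra.
  - rewrite sumR_scal.
    assert (Hs := sum_ln_div_primes q ltac:(lia)).
    assert (H16 := exp_pos 16).
    apply Rle_trans with (20 * (16 * eps q * exp 16 * (2 * ln (INR q)))).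
    + apply Rmult_le_compat_l; [lra|]. apply Rmult_le_compat_l; [nra|easy].
    + replace (20 * (16 * eps q * exp 16 * (2 * ln (INR q))))
        with (640 * exp 16 * (eps q * ln (INR q))) by ring. nra.
Qed.

(** * A sharp majorant of the divisor function on small divisors *)

Definition majorant_block (C : R) (z q : nat) : wlist :=
  flat_map (fun x => map (fun v => (C * Rpower (INR z) (- eps q) * fst x,
                                    (Nat.lcm (snd x) v * q)%nat)) (seq 1 z))
           (rankin (16 * eps q) z q).

(** The filter guarantees divisors at most z^2, so that three of them multiply to at most z^6. The
    factor 2^14 bounds d(b) when all primes of b <= z^7 exceed sqrt z. *)
Definition majorant (C : R) (z : nat) : wlist :=
  filter (fun x => (snd x <=? z * z)%nat)
    (map (fun v => (2 ^ 14, v)) (seq 1 z) ++ flat_map (majorant_block C z) (primes z)).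

Lemma lcm_pos u v : (1 <= u)%nat -> (1 <= v)%nat -> (1 <= Nat.lcm u v)%nat.
Proof.
  intros Hu Hv. assert (Nat.lcm u v <> 0)%nat; [|lia]. intros H.
  apply Nat.lcm_eq_0 in H. lia.
Qed.

Lemma majorant_block_admissible C z q : 0 <= C -> (2 <= q)%nat ->
  admissible (majorant_block C z q).
Proof.
  intros HC Hq x Hx. unfold majorant_block in Hx.
  apply in_flat_map in Hx as (y & Hy & (v & <- & Hv%in_seq)%in_map_iff). cbn [fst snd].
  assert (He := eps_pos q Hq).
  destruct (rankin_admissible (16 * eps q) z q ltac:(lra) y Hy) as [H1 H2].
  split.
  - apply Rmult_le_pos; [|easy]. apply Rmult_le_pos; [easy|left; apply Rpower_pos].
  - assert (H := lcm_pos (snd y) v H2 ltac:(lia)). nia.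
Qed.

Lemma majorant_unfiltered_admissible C z : 0 <= C ->
  admissible (map (fun v => (2 ^ 14, v)) (seq 1 z) ++ flat_map (majorant_block C z) (primes z)).
Proof.
  intros HC x [(v & <- & Hv%in_seq)%in_map_iff|(q & [[Hq _] _]%in_primes & Hx)%in_flat_map]%in_app_iff.
  - cbn [fst snd]. split; [apply pow_le; lra|lia].
  - now apply (majorant_block_admissible C z q).
Qed.

Lemma majorant_admissible C z : 0 <= C -> admissible (majorant C z).
Proof.
  intros HC x [Hx _]%filter_In. now apply (majorant_unfiltered_admissible C z HC).
Qed.

Lemma majorant_bounded C z x : In x (majorant C z) -> (snd x <= z * z)%nat.
Proof. intros [_ Hx]%filter_In. now apply Nat.leb_le. Qed.

(** Carries the size filter inside the summand, so that the filtered majorant splits into its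
    blocks. *)
Definition wdiv_le (B : nat) (L : wlist) (n : nat) : R :=
  sumR (fun x => if (snd x <=? B)%nat then (if dvdb (snd x) n then fst x else 0) else 0) L.

Lemma wdiv_le_nonneg B L n : admissible L -> 0 <= wdiv_le B L n.
Proof.
  intros HL. apply sumR_nonneg. intros x Hx. destruct (HL x Hx).
  destruct (snd x <=? B)%nat, (dvdb (snd x) n); lra.
Qed.

Lemma wdiv_majorant C z n : wdiv (majorant C z) n =
  wdiv_le (z * z) (map (fun v => (2 ^ 14, v)) (seq 1 z)) n +
  sumR (fun q => wdiv_le (z * z) (majorant_block C z q) n) (primes z).
Proof.
  unfold wdiv, majorant. rewrite sumR_filter, sumR_app, sumR_flat_map. reflexivity.
Qed.

(** The constant weights suffice here: d(n) <= 2^14 d(a), and each divisor of a lies in [seq 1 z]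
    and divides n. *)
Lemma majorant_ge_rough C z n a b : 0 <= C -> n = (a * b)%nat ->
  (1 <= a <= z)%nat -> INR (ndiv b) <= 2 ^ 14 -> INR (ndiv n) <= wdiv (majorant C z) n.
Proof.
  intros HC Hn Ha Hb. rewrite wdiv_majorant.
  assert (H0 : 0 <= sumR (fun q => wdiv_le (z * z) (majorant_block C z q) n) (primes z)).
  { apply sumR_nonneg. intros q [[Hq _] _]%in_primes.
    now apply wdiv_le_nonneg, majorant_block_admissible. }
  enough (INR (ndiv n) <= wdiv_le (z * z) (map (fun v => (2 ^ 14, v)) (seq 1 z)) n) by lra.
  unfold wdiv_le. rewrite sumR_map. cbn [fst snd].
  set (F := fun v => if (v <=? z * z)%nat then (if dvdb v n then 2 ^ 14 else 0) else 0).
  assert (H14 : 0 <= 2 ^ 14) by (apply pow_le; lra).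
  apply Rle_trans with (sumR F (divs a)).
  - rewrite (sumR_ext F (fun _ => 2 ^ 14)).
    + rewrite sumR_const, <- ndiv_length, Hn. eapply Rle_trans; [apply ndiv_mul_INR|].
      rewrite Rmult_comm. apply Rmult_le_compat_r; [apply pos_INR|easy].
    + intros v [_ Hv]%in_divs. unfold F.
      assert (v <= a)%nat by (apply Nat.divide_pos_le; [lia|easy]).
      replace (v <=? z * z)%nat with true by (symmetry; apply Nat.leb_le; nia).
      replace (dvdb v n) with true; [easy|]. symmetry; apply dvdb_spec.
      subst n. now apply Nat.divide_mul_l.
  - apply sumR_incl; [| apply NoDup_divs|].
    + intros v. unfold F. destruct (v <=? z * z)%nat, (dvdb v n); lra.
    + intros v [_ Hv]%in_divs.
      assert (v <= a)%nat by (apply Nat.divide_pos_le; [lia|easy]).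
      assert (v <> 0)%nat by (intros ->; destruct Hv; lia).
      apply in_seq; lia.
Qed.

(** If u and v divide a, then lcm(u, v) q divides a q, hence n, and is at most z^2, so it survives
    the filter. Thus each u dividing a is counted d(a) times, and the weights of these u add up to
    at least a^(16 eps). *)
Lemma majorant_block_ge C z q a n : 0 <= C -> (2 <= q <= z)%nat -> smooth q a ->
  (a <= z)%nat -> Nat.divide (a * q) n ->
  C * Rpower (INR z) (- eps q) * Rpower (INR a) (16 * eps q) * INR (ndiv a)
  <= wdiv_le (z * z) (majorant_block C z q) n.
Proof.
  intros HC Hq Ha Haz Hdv. assert (He := eps_pos q ltac:(lia)).
  assert (Ha1 := smooth_pos _ _ Ha).
  assert (Hadm := rankin_admissible (16 * eps q) z q ltac:(lra)).
  assert (Hge := rankin_ge (16 * eps q) z q a ltac:(lra) Ha Haz).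
  set (c := C * Rpower (INR z) (- eps q)).
  assert (Hc : 0 <= c) by (apply Rmult_le_pos; [easy|left; apply Rpower_pos]).
  apply Rle_trans with (c * INR (ndiv a) * wdiv (rankin (16 * eps q) z q) a).
  { rewrite Rmult_assoc, (Rmult_comm (Rpower (INR a) _)), <- Rmult_assoc.
    apply Rmult_le_compat_l; [|easy]. apply Rmult_le_pos; [easy|apply pos_INR]. }
  unfold wdiv, wdiv_le, majorant_block. rewrite sumR_flat_map, <- sumR_scal. fold c.
  apply sumR_le. intros x Hx. destruct (Hadm x Hx) as [H1 H2].
  rewrite sumR_map. cbn [fst snd].
  assert (Hcx : 0 <= c * fst x) by (now apply Rmult_le_pos).
  set (F := fun v => if (Nat.lcm (snd x) v * q <=? z * z)%nat
     then (if dvdb (Nat.lcm (snd x) v * q) n then c * fst x else 0) else 0).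
  assert (HF : forall v, 0 <= F v).
  { intros v. unfold F. destruct (_ <=? _)%nat; [destruct (dvdb _ _)|]; lra. }
  destruct (dvdb (snd x) a) eqn:Hd; [|rewrite Rmult_0_r; apply sumR_nonneg; intros; apply HF].
  apply dvdb_spec in Hd.
  apply Rle_trans with (sumR F (divs a)).
  - rewrite (sumR_ext F (fun _ => c * fst x)).
    + rewrite sumR_const, <- ndiv_length. lra.
    + intros v [_ Hv]%in_divs. unfold F.
      assert (Hl : Nat.divide (Nat.lcm (snd x) v) a) by (now apply Nat.lcm_least).
      assert (Nat.lcm (snd x) v <= a)%nat by (apply Nat.divide_pos_le; [lia|easy]).
      replace (Nat.lcm (snd x) v * q <=? z * z)%nat with true
        by (symmetry; apply Nat.leb_le; nia).
      replace (dvdb (Nat.lcm (snd x) v * q) n) with true; [easy|].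
      symmetry; apply dvdb_spec. eapply Nat.divide_trans; [|exact Hdv].
      now apply Nat.mul_divide_mono_r.
  - apply sumR_incl; [easy|apply NoDup_divs|].
    intros v [_ Hv]%in_divs.
    assert (v <= a)%nat by (apply Nat.divide_pos_le; [lia|easy]).
    assert (v <> 0)%nat by (intros ->; destruct Hv; lia).
    apply in_seq; lia.
Qed.

Lemma prodl_ge_pow q l : Forall (fun p => nprime p /\ (q <= p)%nat) l ->
  (q ^ length l <= prodl l)%nat.
Proof. induction 1 as [|p l [_ Hp] _ IH]; simpl; [lia|nia]. Qed.

Lemma ndiv_prodl_le l : Forall nprime l -> (ndiv (prodl l) <= 2 ^ length l)%nat.
Proof.
  induction 1 as [|p l Hp _ IH]; [apply Nat.le_refl|]. simpl prodl. simpl length.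
  eapply Nat.le_trans; [apply ndiv_mul|]. apply ndiv_prime in Hp.
  rewrite Nat.pow_succ_r'. now apply Nat.mul_le_mono.
Qed.

Lemma Rpower_le_base x y e : 0 < x -> x <= y -> 0 <= e -> Rpower x e <= Rpower y e.
Proof.
  intros Hx Hxy He. unfold Rpower. apply exp_le. apply Rmult_le_compat_l; [easy|].
  now apply ln_le.
Qed.

(* For small q, Rankin's trick 1 <= (a^2 / z)^(8 eps) pays for d(b) << z^(7 eps). *)
Lemma majorant_ge : exists C, 1 <= C /\ forall z n, (2 <= z)%nat ->
  (1 <= n <= z ^ 7)%nat -> INR (ndiv n) <= wdiv (majorant C z) n.
Proof.
  destruct ndiv_rough_le as (C & HC & Hrough). exists C. split; [easy|].
  intros z n Hz Hn.
  destruct (le_lt_dec n z) as [Hnz|Hnz].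
  { apply (majorant_ge_rough C z n n 1); [lra|lia|lia|].
    change (INR (ndiv 1)) with 1. apply pow_R1_Rle. lra. }
  destruct (sorted_factorization n ltac:(lia)) as (l & Hl & Hs & Hpl).
  destruct (prodl_prefix z l ltac:(lia) ltac:(lia)) as (l1 & q & l2 & -> & Hq1 & Hq2).
  apply Forall_app in Hl as [Hl1 Hl2]. inversion Hl2 as [|? ? Hq Hl2']; subst.
  destruct (StronglySorted_middle _ _ _ Hs) as [Hs1 Hs2].
  assert (Hqge := proj1 Hq).
  rewrite prodl_app in *. set (a := prodl l1) in *. set (b := prodl (q :: l2)) in *.
  assert (Ha1 : (1 <= a)%nat) by now apply prodl_pos.
  assert (Hb1 : (1 <= b)%nat) by now apply prodl_pos.
  assert (Hbz : (b <= z ^ 7)%nat) by nia.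
  assert (HQ : Forall (fun p => nprime p /\ (q <= p)%nat) (q :: l2)).
  { constructor; [split; [easy|lia]|]. rewrite Forall_forall in *. auto. }
  destruct (le_lt_dec (q * q) z) as [Hqz|Hqz].
  - assert (Hqz' : (q <= z)%nat) by nia.
    assert (Hsm : smooth q a).
    { exists l1. split; [|easy]. rewrite Forall_forall in *. auto. }
    (* From z < a q and q^2 <= z. *)
    assert (Haz : (z <= a * a)%nat) by nia.
    rewrite wdiv_majorant.
    assert (H0 : 0 <= wdiv_le (z * z) (map (fun v => (2 ^ 14, v)) (seq 1 z)) (a * b)).
    { apply wdiv_le_nonneg. intros x (v & <- & Hv%in_seq)%in_map_iff. cbn [fst snd].
      split; [apply pow_le; lra|lia]. }
    apply Rle_trans with (wdiv_le (z * z) (majorant_block C z q) (a * b)).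
    2: { enough (wdiv_le (z * z) (majorant_block C z q) (a * b)
           <= sumR (fun r => wdiv_le (z * z) (majorant_block C z r) (a * b)) (primes z)) by lra.
         apply (sumR_ge_term (fun r => wdiv_le (z * z) (majorant_block C z r) (a * b))).
         - intros r [[Hr _] _]%in_primes.
           apply wdiv_le_nonneg, majorant_block_admissible; [lra|easy].
         - now apply in_primes. }
    eapply Rle_trans; [|apply (majorant_block_ge C z q a); auto; try lra].
    2: { apply Nat.mul_divide_mono_l. exists (prodl l2). unfold b; simpl; lia. }
    eapply Rle_trans; [apply ndiv_mul_INR|]. rewrite Rmult_comm.
    apply Rmult_le_compat_r; [apply pos_INR|].
    eapply Rle_trans; [apply (Hrough q _ Hqge HQ)|]. fold b.
    rewrite Rmult_assoc. apply Rmult_le_compat_l; [lra|].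
    assert (He := eps_pos q Hqge). assert (Hz2 := INR_ge_2 z Hz).
    assert (Ha' := INR_ge_1 a Ha1). assert (Hb' := INR_ge_1 b Hb1).
    apply Rle_trans with (Rpower (INR z) (7 * eps q)).
    + rewrite <- Rpower_mult. apply Rpower_le_base; [lra| |lra].
      replace 7 with (INR 7) by (simpl; ring). rewrite Rpower_pow by lra.
      rewrite <- pow_INR. now apply le_INR.
    + replace (7 * eps q) with (- eps q + 8 * eps q) by ring. rewrite Rpower_plus.
      apply Rmult_le_compat_l; [left; apply Rpower_pos|].
      replace (16 * eps q) with (8 * eps q + 8 * eps q) by ring.
      rewrite Rpower_plus, Rpower_mult_distr by lra.
      apply Rpower_le_base; [lra| |lra]. rewrite <- mult_INR. now apply le_INR.
  - apply (majorant_ge_rough C z _ a b); [lra|easy|lia|].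
    apply Rle_trans with (INR (2 ^ 14)); [|rewrite pow_INR; apply Rle_refl].
    apply le_INR. eapply Nat.le_trans; [now apply ndiv_prodl_le|].
    apply Nat.pow_le_mono_r; [lia|].
    (* With more than 14 prime factors, all at least q, one would have b >= q^14 > z^7. *)
    assert (Hp := prodl_ge_pow q _ HQ). fold b in Hp.
    destruct (le_lt_dec (length (q :: l2)) 14) as [|Hlen]; [easy|exfalso].
    assert (H1 : (q ^ 14 <= q ^ length (q :: l2))%nat) by (apply Nat.pow_le_mono_r; lia).
    assert (H2 : (z ^ 7 < (q * q) ^ 7)%nat) by (apply Nat.pow_lt_mono_l; lia).
    replace (q * q)%nat with (q ^ 2)%nat in H2 by (simpl; lia).
    rewrite <- Nat.pow_mul_r in H2. change (2 * 7)%nat with 14%nat in H2. lia.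
Qed.

(** * Total mass of the majorant *)

Lemma inv_eps_le q : (2 <= q)%nat -> / eps q <= 65 * ln (INR q).
Proof.
  intros Hq. assert (H := ln_ge_half _ (INR_ge_2 q Hq)).
  unfold eps. apply Rmin_case.
  - replace (/ (1 / 32)) with 32 by field. lra.
  - replace (/ (1 / ln (INR q))) with (ln (INR q)) by (field; lra). lra.
Qed.

(** By exp(-t) <= 1 / t at t = eps ln z. The saving ln q / ln z is what makes the sum over q of
    z^(-eps) / q bounded. *)
Lemma Rpower_neg_le z q : (2 <= z)%nat -> (2 <= q)%nat ->
  Rpower (INR z) (- eps q) <= 65 * ln (INR q) / ln (INR z).
Proof.
  intros Hz Hq. assert (Hlz := ln_ge_half _ (INR_ge_2 z Hz)).
  assert (He := eps_pos q Hq). assert (Hi := inv_eps_le q Hq).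
  unfold Rpower. replace (- eps q * ln (INR z)) with (- (eps q * ln (INR z))) by ring.
  rewrite exp_Ropp.
  assert (H := exp_ineq1_le (eps q * ln (INR z))).
  apply Rle_trans with (/ (eps q * ln (INR z))).
  - apply Rinv_le_contravar; [nra|lra].
  - rewrite Rinv_mult. unfold Rdiv. apply Rmult_le_compat_r; [|easy].
    left; apply Rinv_0_lt_compat; lra.
Qed.

(** The sum over v costs [harm z] d(u) / u, so the sum over u becomes a [wcost], which is bounded;
    [Rpower_neg_le] handles z^(-eps). *)
Lemma majorant_block_mass C z q : 0 <= C -> (2 <= z)%nat -> (2 <= q)%nat ->
  wmass (majorant_block C z q)
  <= C * 65 * exp (640 * exp 16) * harm z / ln (INR z) * (ln (INR q) / INR q).
Proof.
  intros HC Hz Hq. assert (Hq2 := INR_ge_2 q Hq). assert (He := eps_pos q Hq).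
  assert (Hadm := rankin_admissible (16 * eps q) z q ltac:(lra)).
  assert (Hlz := ln_ge_half _ (INR_ge_2 z Hz)).
  assert (Hlq := ln_ge_half _ Hq2).
  assert (Hh := harm_nonneg z).
  unfold wmass, majorant_block. rewrite sumR_flat_map.
  set (c := C * Rpower (INR z) (- eps q)).
  assert (Hc : 0 <= c) by (apply Rmult_le_pos; [easy|left; apply Rpower_pos]).
  assert (Hqi : 0 < / INR q) by (apply Rinv_0_lt_compat; lra).
  apply Rle_trans with (c * harm z / INR q * wcost (rankin (16 * eps q) z q)).
  - unfold wcost. rewrite <- sumR_scal. apply sumR_le. intros x Hx.
    destruct (Hadm x Hx) as [H1 H2]. rewrite sumR_map. cbn [fst snd].
    assert (Hcx : 0 <= c * fst x) by now apply Rmult_le_pos.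
    rewrite (sumR_ext _ (fun v => c * fst x / INR q * / INR (Nat.lcm (snd x) v))).
    + rewrite sumR_scal.
      apply Rle_trans with (c * fst x / INR q * (INR (ndiv (snd x)) / INR (snd x) * harm z)).
      * apply Rmult_le_compat_l; [apply Rmult_le_pos; lra|]. now apply sum_inv_lcm_le.
      * right. apply INR_ge_1 in H2. field. lra.
    + intros v Hv%in_seq. rewrite mult_INR.
      assert (Hl := INR_ge_1 _ (lcm_pos (snd x) v H2 ltac:(lia))). field; lra.
  - assert (Hr := rankin_cost_eps z q Hq). assert (Hp := Rpower_neg_le z q Hz Hq).
    assert (HE := exp_pos (640 * exp 16)). set (E := exp (640 * exp 16)) in *.
    apply Rle_trans with (c * harm z / INR q * E).
    + apply Rmult_le_compat_l; [|easy]. apply Rmult_le_pos; [|lra]. now apply Rmult_le_pos.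
    + replace (C * 65 * E * harm z / ln (INR z) * (ln (INR q) / INR q))
        with (C * harm z / INR q * E * (65 * ln (INR q) / ln (INR z))) by (field; lra).
      unfold c.
      replace (C * Rpower (INR z) (- eps q) * harm z / INR q * E)
        with (C * harm z / INR q * E * Rpower (INR z) (- eps q)) by (field; lra).
      apply Rmult_le_compat_l; [|easy].
      repeat apply Rmult_le_pos; lra.
Qed.

Lemma majorant_mass C : 0 <= C -> exists K, 0 < K /\ forall z, (2 <= z)%nat ->
  wmass (majorant C z) <= K * ln (INR z).
Proof.
  intros HC. set (E := exp (640 * exp 16)). assert (HE : 0 < E) by apply exp_pos.
  assert (HT : 0 < 2 ^ 14) by (apply pow_lt; lra). set (T := 2 ^ 14) in *.
  (* The 3 comes from 1 + ln z <= 3 ln z, as ln z >= 1/2. T belongs to the constant weights, and the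
     rest to the blocks, where the sum of ln q / q is at most 2 ln z and cancels the 1 / ln z. *)
  exists (3 * (T + 2 * (C * 65 * E))). split; [nra|].
  intros z Hz. assert (Hlz := ln_ge_half _ (INR_ge_2 z Hz)).
  assert (Hh := harm_le z ltac:(lia)). assert (Hh0 := harm_nonneg z).
  assert (Hadm := majorant_unfiltered_admissible C z HC).
  unfold wmass, majorant. rewrite sumR_filter.
  eapply Rle_trans.
  { apply (sumR_le _ (fun x => fst x / INR (snd x))). intros x Hx.
    destruct (Hadm x Hx) as [H1 H2]. apply INR_ge_1 in H2.
    destruct (_ <=? _)%nat; [lra|].
    apply Rmult_le_pos; [easy|left; apply Rinv_0_lt_compat; lra]. }
  rewrite sumR_app, sumR_map, sumR_flat_map. cbn [fst snd].
  apply Rle_trans with (T * harm z + harm z * (2 * (C * 65 * E))).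
  - apply Rplus_le_compat.
    + unfold harm. rewrite <- sumR_scal. apply Rle_refl.
    + eapply Rle_trans.
      { apply sumR_le. intros q [[Hq _] _]%in_primes. now apply majorant_block_mass. }
      rewrite sumR_scal. fold E.
      assert (Hs := sum_ln_div_primes z ltac:(lia)).
      apply Rle_trans with (C * 65 * E * harm z / ln (INR z) * (2 * ln (INR z))).
      * apply Rmult_le_compat_l; [|easy].
        repeat apply Rmult_le_pos; try lra. left; apply Rinv_0_lt_compat; lra.
      * right. field. lra.
  - assert (0 <= C * 65 * E) by nra. nra.
Qed.

(** * Simultaneous divisibility *)

(** The product a b divides both a n and n b, hence their gcd, which is gcd(a, b) n. *)
Lemma divide_mul_gcd a b n : Nat.divide a n -> Nat.divide b n ->
  Nat.divide (a * b) (Nat.gcd a b * n).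
Proof.
  intros Ha Hb. assert (Hab : Nat.divide (a * b) (Nat.gcd (a * n) (n * b))).
  { apply Nat.gcd_greatest.
    - now apply Nat.mul_divide_mono_l.
    - now apply Nat.mul_divide_mono_r. }
  rewrite (Nat.mul_comm n b), Nat.gcd_mul_mono_r in Hab. exact Hab.
Qed.

Lemma gcd_mul_divide a b c : Nat.divide (Nat.gcd (a * b) c) (Nat.gcd a c * Nat.gcd b c).
Proof.
  rewrite <- Nat.gcd_mul_mono_l. apply Nat.gcd_greatest.
  - rewrite <- Nat.gcd_mul_mono_r. apply Nat.gcd_greatest.
    + apply Nat.gcd_divide_l.
    + eapply Nat.divide_trans; [apply Nat.gcd_divide_r|]. apply Nat.divide_factor_l.
  - eapply Nat.divide_trans; [apply Nat.gcd_divide_r|]. apply Nat.divide_factor_r.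
Qed.

Definition triple_dvd (h a b c n : nat) : bool :=
  dvdb a n && dvdb b (natdist n h) && dvdb c (n + h).

Lemma divide_natdist d n h : Nat.divide d n -> Nat.divide d (natdist n h) -> Nat.divide d h.
Proof.
  unfold natdist. destruct (h <=? n)%nat eqn:E; intros H1 H2.
  - apply Nat.leb_le in E. apply (Nat.divide_add_cancel_r d (n - h)); [easy|].
    now replace (n - h + h)%nat with n by lia.
  - apply Nat.leb_gt in E. replace h with (n + (h - n))%nat by lia. now apply Nat.divide_add_r.
Qed.

Lemma divide_natdist_sub b n m h : (m <= n)%nat ->
  Nat.divide b (natdist n h) -> Nat.divide b (natdist m h) -> Nat.divide b (n - m).
Proof.
  unfold natdist. intros Hmn [x Hx] [y Hy].
  destruct (h <=? n)%nat eqn:E1; destruct (h <=? m)%nat eqn:E2;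
    rewrite ?Nat.leb_le, ?Nat.leb_gt in *; try lia.
  - exists (x - y)%nat. rewrite Nat.mul_sub_distr_r. lia.
  (* Here m < h <= n, so n - m is the sum of the two distances to h. *)
  - exists (x + y)%nat. lia.
  - exists (y - x)%nat. rewrite Nat.mul_sub_distr_r. lia.
Qed.

(* The three moduli are pairwise coprime up to divisors of h, h and 2h. *)
Lemma triple_dvd_sub h a b c n m : (m <= n)%nat ->
  triple_dvd h a b c n = true -> triple_dvd h a b c m = true ->
  Nat.divide (a * b * c) (2 * h ^ 3 * (n - m)).
Proof.
  unfold triple_dvd. rewrite !Bool.andb_true_iff, !dvdb_spec.
  intros Hmn [[Ha Hb] Hc] [[Ha' Hb'] Hc'].
  assert (Hab : Nat.divide (Nat.gcd a b) h).
  { apply divide_natdist with n; eapply Nat.divide_trans;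
      [apply Nat.gcd_divide_l|easy|apply Nat.gcd_divide_r|easy]. }
  assert (Hac : Nat.divide (Nat.gcd a c) h).
  { apply (Nat.divide_add_cancel_r _ n); eapply Nat.divide_trans;
      [apply Nat.gcd_divide_l|easy|apply Nat.gcd_divide_r|easy]. }
  assert (Hbc : Nat.divide (Nat.gcd b c) (2 * h)).
  { assert (H1 : Nat.divide (Nat.gcd b c) (natdist n h))
      by (eapply Nat.divide_trans; [apply Nat.gcd_divide_l|easy]).
    assert (H2 : Nat.divide (Nat.gcd b c) (n + h))
      by (eapply Nat.divide_trans; [apply Nat.gcd_divide_r|easy]).
    revert H1 H2. generalize (Nat.gcd b c). unfold natdist. intros d.
    destruct (h <=? n)%nat eqn:E; intros H1 H2.
    - apply Nat.leb_le in E. apply (Nat.divide_add_cancel_r d (n - h)); [easy|].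
      now replace (n - h + 2 * h)%nat with (n + h)%nat by lia.
    - apply Nat.leb_gt in E. replace (2 * h)%nat with (h - n + (n + h))%nat by lia.
      now apply Nat.divide_add_r. }
  assert (Da : Nat.divide a (n - m)) by now apply Nat.divide_sub_r.
  assert (Db : Nat.divide b (n - m)) by now apply (divide_natdist_sub b n m h).
  assert (Dc : Nat.divide c (n - m)).
  { replace (n - m)%nat with (n + h - (m + h))%nat by lia. now apply Nat.divide_sub_r. }
  assert (D1 : Nat.divide (a * b) (h * (n - m))).
  { eapply Nat.divide_trans; [exact (divide_mul_gcd a b _ Da Db)|].
    now apply Nat.mul_divide_mono_r. }
  eapply Nat.divide_trans; [apply (divide_mul_gcd (a * b) c (h * (n - m)) D1)|].
  { now apply Nat.divide_mul_r. }
  (* One h was spent on gcd(a, b); the factor h · 2h pays for gcd(a b, c), which divides gcd(a, c)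
     gcd(b, c). *)
  replace (2 * h ^ 3 * (n - m))%nat with (h * (2 * h) * (h * (n - m)))%nat by (simpl; ring).
  apply Nat.mul_divide_mono_r.
  eapply Nat.divide_trans; [apply gcd_mul_divide|].
  eapply Nat.divide_trans; [apply Nat.mul_divide_mono_r, Hac|].
  now apply Nat.mul_divide_mono_l.
Qed.

Lemma triple_dvd_count h a b c N : (0 < h)%nat -> (1 <= a)%nat -> (1 <= b)%nat -> (1 <= c)%nat ->
  (a * b * c <= N)%nat ->
  INR (length (filter (triple_dvd h a b c) (seq 1 N)))
  <= INR (2 * h ^ 3 + 1) * INR N * (/ INR a * / INR b * / INR c).
Proof.
  intros Hh Ha Hb Hc HN. set (M := (a * b * c)%nat) in *. set (K := (2 * h ^ 3)%nat).
  assert (HM : (1 <= M)%nat) by (unfold M; nia).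
  assert (Hlen : (length (filter (triple_dvd h a b c) (seq 1 N)) <= K * N / M + 1)%nat).
  (* Solutions differ by amounts whose K-fold is a multiple of M, so n maps injectively to the
     quotient of K n by M, which takes at most K N / M + 1 values. *)
  { rewrite <- (length_seq (K * N / M + 1) 0), <- (length_map (fun n => (K * n / M)%nat)).
    apply NoDup_incl_length.
    - apply NoDup_map_on; [|apply NoDup_filter, seq_NoDup].
      assert (Hw : forall n m, (m <= n)%nat -> triple_dvd h a b c n = true ->
         triple_dvd h a b c m = true -> (K * n / M = K * m / M)%nat -> n = m).
      { intros n m Hmn Hn Hm Heq.
        destruct (triple_dvd_sub h a b c n m Hmn Hn Hm) as [d Hd]. fold K M in Hd.
        replace (K * n)%nat with (K * m + d * M)%nat in Heq
          by (rewrite <- Hd, Nat.mul_sub_distr_l; assert (K * m <= K * n)%nat by (now apply Nat.mul_le_mono_l); lia).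
        rewrite Nat.div_add in Heq by lia. assert (d = 0)%nat by lia. subst d.
        assert (HK : (1 <= K)%nat).
        { unfold K. assert (h ^ 3 <> 0)%nat by (apply Nat.pow_nonzero; lia). lia. }
        nia. }
      intros n m [_ Hn]%filter_In [_ Hm]%filter_In Heq.
      destruct (Nat.le_ge_cases m n) as [H|H]; [now apply Hw|symmetry; now apply Hw].
    - intros k (n & <- & [Hn _]%filter_In)%in_map_iff. apply in_seq in Hn. apply in_seq.
      assert (K * n / M <= K * N / M)%nat by (apply Nat.Div0.div_le_mono; nia). lia. }
  (* The rounding term 1 costs M after multiplication, and M <= N absorbs it. Hence the + 1 in the
     constant. *)
  assert (Hmul : (length (filter (triple_dvd h a b c) (seq 1 N)) * M <= (K + 1) * N)%nat).
  { assert (M * (K * N / M) <= K * N)%nat by apply Nat.Div0.mul_div_le. nia. }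
  apply le_INR in Hmul. rewrite !mult_INR in Hmul. unfold M in Hmul. rewrite !mult_INR in Hmul.
  apply INR_ge_1 in Ha, Hb, Hc.
  assert (0 < INR a * INR b * INR c) by (apply Rmult_lt_0_compat; [nra|lra]).
  apply Rmult_le_reg_r with (INR a * INR b * INR c); [easy|].
  replace (INR (K + 1) * INR N * (/ INR a * / INR b * / INR c) * (INR a * INR b * INR c))
    with (INR (K + 1) * INR N) by (field; lra).
  exact Hmul.
Qed.

(** * The triple correlation *)

Lemma sumR_cube {A} (f g k : A -> R) l :
  sumR f l * sumR g l * sumR k l =
  sumR (fun x => sumR (fun y => sumR (fun w => f x * g y * k w) l) l) l.
Proof.
  rewrite Rmult_assoc, Rmult_comm, <- sumR_scal. apply sumR_ext. intros x _.
  rewrite Rmult_comm, <- Rmult_assoc, Rmult_comm, <- sumR_scal.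
  rewrite (sumR_ext (fun y => sumR _ l) (fun y => f x * g y * sumR k l)).
  2: { intros y _. now rewrite sumR_scal. }
  rewrite (sumR_ext (fun y => f x * g y * sumR k l) (fun y => (f x * sumR k l) * g y))
    by (intros; ring).
  rewrite sumR_scal, sumR_scal. ring.
Qed.

(** Expand the three weighted sums and sum over n first. The condition B^3 <= N makes
    [triple_dvd_count] available for every triple of divisors, and the resulting bound factors into
    three masses. *)
Lemma sum_triple_wdiv_le h N (L : wlist) B : (0 < h)%nat -> admissible L ->
  (forall x, In x L -> (snd x <= B)%nat) -> (B * B * B <= N)%nat ->
  sumR (fun n => wdiv L n * wdiv L (natdist n h) * wdiv L (n + h)) (seq 1 N)
  <= INR (2 * h ^ 3 + 1) * INR N * wmass L ^ 3.
Proof.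
  intros Hh HL HB HN.
  set (K := INR (2 * h ^ 3 + 1) * INR N).
  unfold wdiv at 1 2 3.
  rewrite (sumR_ext _ (fun n => sumR (fun x => sumR (fun y => sumR (fun w =>
     fst x * fst y * fst w *
       (if triple_dvd h (snd x) (snd y) (snd w) n then 1 else 0)) L) L) L)).
  2: { intros n _. rewrite sumR_cube. apply sumR_ext; intros x _.
       apply sumR_ext; intros y _. apply sumR_ext; intros w _.
       unfold triple_dvd.
       destruct (dvdb (snd x) n), (dvdb (snd y) (natdist n h)), (dvdb (snd w) (n + h)); simpl; ring. }
  rewrite sumR_swap.
  replace (K * wmass L ^ 3) with (K * (wmass L * wmass L * wmass L)) by ring.
  unfold wmass. rewrite sumR_cube, <- sumR_scal. apply sumR_le. intros x Hx.
  rewrite sumR_swap, <- sumR_scal. apply sumR_le. intros y Hy.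
  rewrite sumR_swap, <- sumR_scal. apply sumR_le. intros w Hw.
  destruct (HL x Hx) as [Hx1 Hx2], (HL y Hy) as [Hy1 Hy2], (HL w Hw) as [Hw1 Hw2].
  assert (HBx := HB x Hx). assert (HBy := HB y Hy). assert (HBw := HB w Hw).
  rewrite sumR_scal, (sumR_count (triple_dvd h (snd x) (snd y) (snd w))), Rmult_1_l.
  replace (K * (fst x / INR (snd x) * (fst y / INR (snd y)) * (fst w / INR (snd w))))
    with (fst x * fst y * fst w * (K * (/ INR (snd x) * / INR (snd y) * / INR (snd w))))
    by (unfold Rdiv; ring).
  apply Rmult_le_compat_l; [apply Rmult_le_pos; [now apply Rmult_le_pos|easy]|].
  apply triple_dvd_count; auto.
  eapply Nat.le_trans; [|exact HN]. apply Nat.mul_le_mono; [|easy]. now apply Nat.mul_le_mono.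
Qed.

(** The lower bound keeps triples of divisors up to z^2 within N; the upper bound is what later
    yields 2 N <= z^7. *)
Lemma sixth_root N : (1 <= N)%nat -> exists z, (1 <= z)%nat /\ (z ^ 6 <= N < (z + 1) ^ 6)%nat.
Proof.
  intros HN. induction HN as [|N HN (z & Hz & H1 & H2)].
  - exists 1%nat. simpl; lia.
  - destruct (le_lt_dec ((z + 1) ^ 6) (Datatypes.S N)) as [H|H].
    + exists (z + 1)%nat. split; [lia|]. split; [easy|].
      assert ((z + 1) ^ 6 < (z + 1 + 1) ^ 6)%nat by (apply Nat.pow_lt_mono_l; lia). lia.
    + exists z. lia.
Qed.

Theorem theorem1p2 (h : nat) (hpos : (0 < h)%nat) :
  exists C : R, 0 < C /\
    exists X : R, forall x : R, X <= x -> S x h <= C * x * (ln x) ^ 3.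
Proof.
  destruct majorant_ge as (C0 & HC0 & Hmaj).
  destruct (majorant_mass C0 ltac:(lra)) as (K & HK & Hmass).
  exists (INR (2 * h ^ 3 + 1) * K ^ 3). split.
  { apply Rmult_lt_0_compat; [apply lt_0_INR; lia|now apply pow_lt]. }
  (* Large enough for N >= h and z >= 128; the final 1 allows for the rounding of x to N. *)
  exists (INR (h + 128 ^ 6) + 1). intros x Hx.
  change (S x h) with (sumR (Sterm h) (seq 1 (Z.to_nat (Int_part x)))).
  set (N := Z.to_nat (Int_part x)).
  destruct (base_Int_part x) as [Hi1 Hi2].
  assert (Hpos128 := pos_INR (h + 128 ^ 6)).
  assert (HNx : INR N = IZR (Int_part x)).
  { unfold N. rewrite INR_IZR_INZ, Z2Nat.id; [easy|]. apply le_IZR.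
    enough (-1 < Int_part x)%Z by (apply IZR_le; lia). apply lt_IZR. lra. }
  assert (HNlow : (h + 128 ^ 6 <= N)%nat) by (apply INR_le; lra).
  destruct (sixth_root N ltac:(lia)) as (z & Hz1 & Hz6 & HzN).
  assert (Hz : (128 <= z)%nat).
  { destruct (le_lt_dec 128 z) as [|Hlt]; [easy|exfalso].
    assert ((z + 1) ^ 6 <= 128 ^ 6)%nat by (apply Nat.pow_le_mono_l; lia). lia. }
  (* Indeed 2 N < 2 (z + 1)^6 <= 128 z^6 <= z^7. The majorant thus applies up to n + h <= 2 N. *)
  assert (Hz7 : (2 * N <= z ^ 7)%nat).
  { assert (H1 : ((z + 1) ^ 6 <= (2 * z) ^ 6)%nat) by (apply Nat.pow_le_mono_l; lia).
    rewrite Nat.pow_mul_l in H1. change (z ^ 7)%nat with (z * z ^ 6)%nat.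
    change (2 ^ 6)%nat with 64%nat in H1. nia. }
  clear HzN. set (L := majorant C0 z).
  assert (HL : admissible L) by (apply majorant_admissible; lra).
  assert (Hz2 := INR_ge_2 z ltac:(lia)).
  assert (Hlz := ln_ge_half _ Hz2).
  apply Rle_trans with
    (sumR (fun n => wdiv L n * wdiv L (natdist n h) * wdiv L (n + h)) (seq 1 N)).
  { assert (Hpos : forall n, 0 <= wdiv L n).
    { intros n. apply sumR_nonneg. intros y Hy. destruct (HL y Hy), (dvdb (snd y) n); lra. }
    apply sumR_le. intros n Hn%in_seq. unfold Sterm.
    destruct (n =? h)%nat eqn:E.
    (* The excluded n = h is 0 on the left; its nonnegative product simply stays in the upper
       bound. *)
    - apply Rmult_le_pos; [now apply Rmult_le_pos|easy].
    - apply Nat.eqb_neq in E.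
      assert (Hnd : (1 <= natdist n h <= N)%nat).
      { unfold natdist. destruct (h <=? n)%nat eqn:E';
          rewrite ?Nat.leb_le, ?Nat.leb_gt in E'; lia. }
      rewrite !mult_INR. apply Rmult_le_compat; try apply pos_INR.
      + apply Rmult_le_pos; apply pos_INR.
      + apply Rmult_le_compat; try apply pos_INR; apply Hmaj; lia.
      + apply Hmaj; lia. }
  eapply Rle_trans.
  { apply (sum_triple_wdiv_le h N L (z * z) hpos HL); [apply majorant_bounded|].
    simpl in Hz6. lia. }
  assert (HNx' : INR N <= x) by lra.
  assert (HzN : INR z <= x).
  { apply Rle_trans with (INR N); [|easy]. apply le_INR.
    apply Nat.le_trans with (z ^ 6)%nat; [|easy].
    rewrite <- (Nat.pow_1_r z) at 1. apply Nat.pow_le_mono_r; lia. }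
  assert (Hlx : ln (INR z) <= ln x) by (apply ln_le; lra).
  assert (Hm := Hmass z ltac:(lia)). fold L in Hm.
  assert (Hm0 : 0 <= wmass L).
  { apply sumR_nonneg. intros y Hy. destruct (HL y Hy) as [H1 H2].
    apply Rmult_le_pos; [easy|left; apply Rinv_0_lt_compat, lt_0_INR; lia]. }
  replace (INR (2 * h ^ 3 + 1) * K ^ 3 * x * ln x ^ 3)
    with (INR (2 * h ^ 3 + 1) * x * (K * ln x) ^ 3) by ring.
  apply Rmult_le_compat.
  - apply Rmult_le_pos; apply pos_INR.
  - now apply pow_le.
  - apply Rmult_le_compat_l; [apply pos_INR|easy].
  - apply pow_incr. split; [easy|].
    eapply Rle_trans; [exact Hm|]. apply Rmult_le_compat_l; lra.
Qed.
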